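(* Let $P\in\mathfrak N_2$. Then $P$ has a retract $R$ which is a tower of nice sections and has a level index $\ell$ with $R(\ell)\cup R(\ell+1)$ of type $32$ if and only if $P$ is a $(U,V,W)$-stack where: (i) $U$ is a 6-crown or an element of $\mathfrak N_2$; (ii) $V\in\mathfrak N^{Seg}_2$ is a section of width three with $h_V\ge2$ even and $V(1\to h_V)$ a $3C$-stack; (iii) $W\in\mathfrak N_2$ with $h_W\ge3$ has a retraction $s:W\to S$ such that $S$ is a tower of nice sections, $S(0)\cup S(1)$ is of type $22$, $s[W(1)]\cap S(0)=\emptyset$, and $h_S\ge 2$.
   Context: All posets are finite; $h_P$ is the height. Level sets: $P(0)=\min P$, $P(k+1)=\min(P\setminus\bigcup_{i\le k}P(i))$; $P(k,\ell)=P(k)\cup P(\ell)$, $P(k\to\ell)=\bigcup_{i=k}^\ell P(i)$, identified with induced subposets. $A<B$ means $a<b$ for all $a\in A,b\in B$. A retraction is an idempotent order-preserving self-map; its image is a retract. Level indices of a retract refer to its own level sets. A 6-crown is $x_0<y_0>x_1<y_1>x_2<y_2>x_0$ with no other comparabilities. For antichains $A,B$ of sizes $m,n\in\{2,3\}$, type $mn$ means isomorphic to the ordinal sum $A\oplus B$. Type $3C$: three disjoint 2-chains, no further comparabilities. A $3C$-stack is a poset $Q$ with $Q(i,i+1)$ of type $3C$ for all $i\in[0,h_Q-1]$. For posets $Q_1,\dots,Q_n$, $P$ is a $(Q_1,\dots,Q_n)$-stack if $h_P=\sum_j h_{Q_j}$ and $P\big(\sum_{j<J}h_{Q_j}\to\sum_{j\le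 J}h_{Q_j}\big)\cong Q_J$ for all $J\in[1,n]$. A section is either a 2-element antichain or a poset $P$ of height $h_P\ge1$ with carrier $\{c_{k,j}:k\in[0,h_P],j\in\{0,1,2\}\}$ such that: $c_{0,j}<\dots<c_{h_P,j}$ for each $j$; each $\{c_{k,0},c_{k,1},c_{k,2}\}$ is an antichain; $c_{k,i}<c_{\ell,j}\Rightarrow c_{k,i+1}<c_{\ell,j+1}$ (indices mod 3); no $P(k,k+1)$ is of type $33$ (the latter kind is a section of width three). A section is nice if for all $x<y$: $\{z:z>x\}\not\subseteq\{z:z\ge y\}$ and $\{z:z<y\}\not\subseteq\{z:z\le x\}$. A tower of (nice) sections is an ordinal sum of (nice) sections. The horizon of a nice section of height $\ge2$ is the least $\eta$ with $P(k)<P(k+\eta)$ for all $k\in[0,h_P-\eta]$. $\mathfrak N_2$ is the class of nice sections of height $\ge2$ and horizon 2. $\mathfrak N^{Seg}_2=\{P(1\to h_P-1):P\in\mathfrak N_2\}$. *)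

(* Defs.v *)
(* Finite posets are finite partially ordered types
   [T : finPOrderType d]; induced subposets are subsets [A : {set T}]
   carrying the restriction of the order of [T]. *)
From HB Require Import structures.
From mathcomp Require Import all_boot all_order.

Set Implicit Arguments.
Unset Strict Implicit.
Unset Printing Implicit Defensive.

Import Order.Theory.

Section PosetDefs.
Context {d : Order.disp_t} {T : finPOrderType d}.
Implicit Types (A B X Y : {set T}).

Definition minset A : {set T} := [set x in A | [forall y in A, ~~ (y < x)%O]].

Definition remlev A (k : nat) : {set T} := iter k (fun B => B :\: minset B) A.

Definition lev A (k : nat) : {set T} := minset (remlev A k).

Definition height A : nat := \max_(k < #|A|.+1 | lev A k != set0) (k : nat).

Definition seg A (k l : nat) : {set T} := \bigcup_(k <= i < l.+1) lev A i.

Definition setlt A B : Prop := forall a b, a \in A -> b \in B -> (a < b)%O.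

Definition type_mn A (m n : nat) : Prop :=
  exists X Y, [/\ X :&: Y = set0, A = X :|: Y, #|X| = m, #|Y| = n &
    {in A &, forall a b, (a < b)%O = (a \in X) && (b \in Y)}].

Definition type_3C A : Prop :=
  exists a0 a1 a2 b0 b1 b2 : T,
    [/\ A = [set a0; a1; a2; b0; b1; b2], #|A| = 6 &
      {in A &, forall x y, (x < y)%O =
         [|| (x == a0) && (y == b0), (x == a1) && (y == b1)
           | (x == a2) && (y == b2)]}].

Definition crown6 A : Prop :=
  exists x0 x1 x2 y0 y1 y2 : T,
    [/\ A = [set x0; x1; x2; y0; y1; y2], #|A| = 6 &
      {in A &, forall a b, (a < b)%O =
         [|| (a == x0) && (b == y0), (a == x1) && (b == y0),
             (a == x1) && (b == y1), (a == x2) && (b == y1),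
             (a == x2) && (b == y2) | (a == x0) && (b == y2)]}].

Definition stack3C A : Prop :=
  forall i, i < height A -> type_3C (lev A i :|: lev A i.+1).

Definition section3 A : Prop :=
  exists (h : nat) (c : nat -> nat -> T),
  [/\ 1 <= h, h = height A &
      A = \bigcup_(k < h.+1) \bigcup_(j < 3) [set c k j]] /\
  [/\
      (forall k l i j, k <= h -> l <= h -> i < 3 -> j < 3 ->
          c k i = c l j -> k = l /\ i = j),
      (forall k j, k < h -> j < 3 -> (c k j < c k.+1 j)%O),
      (forall k i j, k <= h -> i < 3 -> j < 3 -> ~~ (c k i < c k j)%O),
      (forall k l i j, k <= h -> l <= h -> i < 3 -> j < 3 ->
          (c k i < c l j)%O -> (c k (i.+1 %% 3) < c l (j.+1 %% 3))%O) &
      (forall k, k < h -> ~ type_mn (lev A k :|: lev A k.+1) 3 3)].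

Definition section A : Prop :=
  (exists x y : T, [/\ x != y, A = [set x; y], ~~ (x < y)%O & ~~ (y < x)%O])
  \/ section3 A.

Definition nice A : Prop :=
  forall x y, x \in A -> y \in A -> (x < y)%O ->
    ~ ([set z in A | (x < z)%O] \subset [set z in A | (y <= z)%O]) /\
    ~ ([set z in A | (z < y)%O] \subset [set z in A | (z <= x)%O]).

Definition nice_section A : Prop := section A /\ nice A.

Definition tower_nice A : Prop :=
  exists s : seq {set T},
  [/\ s != [::], A = \bigcup_(B <- s) B,
      (forall B, B \in s -> nice_section B) &
      (forall i j, i < j -> j < size s -> setlt (nth set0 s i) (nth set0 s j))].

Definition horizon_prop A (eta : nat) : Prop :=
  forall k, k <= height A - eta -> setlt (lev A k) (lev A (k + eta)).

Definition horizon A (eta : nat) : Prop :=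
  horizon_prop A eta /\ forall e, e < eta -> ~ horizon_prop A e.

Definition in_N2 A : Prop :=
  [/\ nice_section A, 2 <= height A & horizon A 2].

Definition retraction (r : T -> T) : Prop :=
  (forall x, r (r x) = r x) /\ (forall x y, (x <= y)%O -> (r x <= r y)%O).

End PosetDefs.

Definition poset_iso {d1 d2 : Order.disp_t} {T1 : finPOrderType d1}
  {T2 : finPOrderType d2} (A : {set T1}) (B : {set T2}) : Prop :=
  exists f : T1 -> T2,
  [/\ {in A &, injective f}, f @: A = B &
      {in A &, forall x y, (f x <= f y)%O = (x <= y)%O}].

Definition in_N2Seg {d : Order.disp_t} {T : finPOrderType d} (A : {set T}) : Prop :=
  exists (dQ : Order.disp_t) (Q : finPOrderType dQ),
    in_N2 [set: Q] /\ poset_iso A (seg [set: Q] 1 (height [set: Q]).-1).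

Definition stack3 {d dU dV dW : Order.disp_t} (P : finPOrderType d)
  (U : finPOrderType dU) (V : finPOrderType dV) (W : finPOrderType dW) : Prop :=
  let hU := height [set: U] in
  let hV := height [set: V] in
  let hW := height [set: W] in
  [/\ height [set: P] = hU + hV + hW,
      poset_iso (seg [set: P] 0 hU) [set: U],
      poset_iso (seg [set: P] hU (hU + hV)) [set: V] &
      poset_iso (seg [set: P] (hU + hV) (hU + hV + hW)) [set: W]].

(* Main.v *)
(* A member of N_2 is determined by a word in two letters: every pair of
   consecutive levels is a 6-crown (letter [true]) or of type 3C ([false]), and
   levels at distance at least 2 are completely comparable.

   Let B be a section of width three of the retract R.  The crowns at the two
   ends of B are crowns between full levels of P, so everything above the top
   level of B is mapped above B.  If a 2-antichain Y follows B in R, comparing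
   the elements of P just below Y with their images shows that Y lies in the
   second level above B and that the two levels in front of it form a 3C; then
   the next section of R is again a 2-antichain, and the argument repeats two
   levels higher as long as the word continues with 3C.  At the first crown,
   everything above is retracted by the given map, which is W.

   Conversely, the retraction of W is extended downwards, two levels at a time:
   each pair of levels of type 3C is folded onto two elements of its upper
   level, until U is reached, where the identity is used. *)
Require Import Defs.
From HB Require Import structures.
From mathcomp Require Import all_boot all_order zify.
Set Implicit Arguments.
Unset Strict Implicit.
Unset Printing Implicit Defensive.
Import Order.Theory.
(* Again, because [finset.minset] would otherwise shadow [Defs.minset]. *)
Import Defs.

(** * Levels of finite posets *)

(** The forward direction rests on one remark: if [x] is mapped into a two-element section [Y] or
    above it, and [x <= y] with [y] in [Y], then [x] is mapped to [y] itself. So no such [x] lies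
    below both elements of [Y]; this fixes the level of [Y] and excludes a crown just below it. How
    the sections of the retract sit in P is not known beforehand, so the induction only carries a
    threshold [t] from which on the map goes into [Y] or above it. The height of V is even because
    every 3C pair that is passed takes exactly two levels. The letter between V(0) and V(1) stays
    free in both directions: the image above U begins at least two levels above the top of U, where
    everything is comparable. The first crown ends the climb because an element directly above a
    crown pair can dominate both elements of [Y]; the next antichain may then touch the very next
    level and the step by two is no longer forced. *)

Section Levels.
Context {d : Order.disp_t} {T : finPOrderType d}.
Implicit Types (A B : {set T}).

Lemma minset_neq0 A : A != set0 -> minset A != set0.
Proof.
case/set0Pn=> x0 x0A; apply/set0Pn.
case: (arg_minnP (fun x => #|[set y | (y < x)%O]|) x0A) => x xA xmin.
exists x; rewrite inE (xA : x \in A); apply/forall_inP => y yA; apply/negP => yx.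
have := xmin y yA; rewrite leqNgt => /negP; apply; apply: proper_card.
apply/properP; split; last by exists y; rewrite !inE ?ltxx.
by apply/subsetP => z; rewrite !inE => /lt_trans; apply.
Qed.

Lemma minset_sub A : minset A \subset A.
Proof. by apply/subsetP => x; rewrite inE => /andP[]. Qed.

Lemma remlevS A k : remlev A k.+1 = remlev A k :\: lev A k.
Proof. by []. Qed.

Lemma remlev_eq0 A k : (remlev A k == set0) = (lev A k == set0).
Proof.
apply/idP/idP => [/eqP e|]; first by rewrite -subset0 -e minset_sub.
by apply: contraLR => /minset_neq0.
Qed.

Lemma lev_sub A k : lev A k \subset A.
Proof.
apply: subset_trans (minset_sub _) _.
elim: k => // k; apply: subset_trans; exact: subsetDl.
Qed.

Lemma lev_card A k : lev A k != set0 -> k < #|A|.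
Proof.
rewrite -remlev_eq0 => n0.
suff: k + #|remlev A k| <= #|A|.
  by apply: leq_trans; rewrite -[X in X < _]addn0 ltn_add2l card_gt0.
elim: k n0 => // k IH; rewrite remlevS => n0.
have n0k : remlev A k != set0.
  by apply: contraNneq n0 => ->; rewrite set0D.
have l0 : lev A k != set0 by rewrite -remlev_eq0.
have := IH n0k; rewrite -(cardsID (lev A k) (remlev A k)).
rewrite (setIidPr (minset_sub _)).
rewrite -card_gt0 in l0; move: (_ :\: _) l0 => B.
by rewrite -/(lev A k); lia.
Qed.

Lemma lev_eq0_le A k l : k <= l -> lev A k = set0 -> lev A l = set0.
Proof.
move=> /subnKC <- /eqP; rewrite -remlev_eq0 => /eqP e.
apply/eqP; rewrite -remlev_eq0; apply/eqP.
by elim: (l - k) => [|n IH]; rewrite ?addn0 ?addnS // remlevS IH set0D.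
Qed.

Lemma height_eq A h : lev A h != set0 -> lev A h.+1 = set0 -> height A = h.
Proof.
move=> hh hS; apply/eqP; rewrite eqn_leq; apply/andP; split.
  apply/bigmax_leqP => k; rewrite leqNgt; apply: contra => hk.
  by rewrite (lev_eq0_le hk hS).
have hA : h < #|A|.+1 by rewrite ltnS ltnW // lev_card.
exact: (@leq_bigmax_cond _ _ (fun k : 'I_ _ => k : nat) (Ordinal hA)).
Qed.

Lemma lev_le_height A k : lev A k != set0 -> k <= height A.
Proof.
move=> hk; have hA : k < #|A|.+1 by rewrite ltnS ltnW // lev_card.
exact: (@leq_bigmax_cond _ _ (fun k : 'I_ _ => k : nat) (Ordinal hA)).
Qed.

(** An element of rank greater than [l] has a smaller element whose rank is still at least [l], so
    the minimal elements of the part of rank at least [l] are those of rank exactly [l]. All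
    explicit level computations below go through such a rank. *)
Lemma ranked_lev A (rk : T -> nat) :
    {in A &, forall x y, (x < y)%O -> rk x < rk y} ->
    {in A, forall x, 0 < rk x ->
       exists2 y, y \in A & (y < x)%O /\ (rk y).+1 = rk x} ->
  forall k, lev A k = [set x in A | rk x == k].
Proof.
move=> mono pred k.
have minE l : minset [set x in A | l <= rk x] = [set x in A | rk x == l].
  apply/setP => x; rewrite !inE -andbA; apply: andb_id2l => xA.
  apply/andP/eqP => [[lx /forall_inP nlt]|<-]; last first.
    rewrite leqnn; split=> //; apply/forall_inP => y; rewrite inE => /andP[yA].
    by rewrite leqNgt; apply: contra; apply: mono.
  apply/eqP; rewrite eqn_leq lx andbT leqNgt; apply/negP => lt.
  have [y yA [yx e]] := pred x xA (leq_ltn_trans (leq0n _) lt).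
  have := nlt y; rewrite inE yA yx -ltnS e lt; exact/implyP.
rewrite /lev -minE; congr minset.
elim: k => [|k IH]; first by apply/setP => x; rewrite inE andbT.
rewrite remlevS /lev IH minE; apply/setP => x; rewrite !inE.
by case: (x \in A); rewrite //= ltn_neqAle eq_sym.
Qed.

Lemma minset_sum A B : A != set0 -> setlt A B -> minset (A :|: B) = minset A.
Proof.
move=> A0 AB; apply/setP => x; rewrite !inE.
have [a amin] := set0Pn _ (minset_neq0 A0).
have aA := subsetP (minset_sub A) _ amin.
apply/andP/andP => -[xA /forall_inP h]; split.
- case/orP: xA => // xB; have := h a; rewrite inE aA AB //; by move=> /(_ isT).
- by apply/forall_inP => y yA; apply: h; rewrite inE yA.
- by rewrite xA.
- apply/forall_inP => y; rewrite inE => /orP[/h //|yB].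
  by apply/negP => /(lt_trans (AB _ _ xA yB)); rewrite ltxx.
Qed.

Lemma setltS A A' B : A' \subset A -> setlt A B -> setlt A' B.
Proof. by move=> /subsetP s AB a b /s; apply: AB. Qed.

Lemma setlt_disj A B : setlt A B -> A :&: B = set0.
Proof.
move=> AB; apply/setP => x; rewrite !inE; apply/andP => -[xA xB].
by have := AB _ _ xA xB; rewrite ltxx.
Qed.

Lemma remlev_sub A k : remlev A k \subset A.
Proof. by elim: k => // k; apply: subset_trans; exact: subsetDl. Qed.

Lemma remlev_sum A B k :
    setlt A B -> (forall i, i < k -> lev A i != set0) ->
  remlev (A :|: B) k = remlev A k :|: B.
Proof.
move=> AB; elim: k => // k IH n0; rewrite !remlevS /lev IH; last first.
  by move=> i /ltnW; apply: n0.
have n0k : remlev A k != set0 by rewrite remlev_eq0 n0.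
rewrite minset_sum //; last exact: setltS (remlev_sub _ _) AB.
rewrite setDUl; congr setU; apply/setDidPl; rewrite disjoint_sym.
rewrite -setI_eq0 -subset0 -(setlt_disj AB) setSI //.
exact: lev_sub.
Qed.

Lemma lev_sum_lo A B k :
  setlt A B -> lev A k != set0 -> lev (A :|: B) k = lev A k.
Proof.
move=> AB n0; rewrite /lev remlev_sum //; last first.
  by move=> i ik; apply: contra n0 => /eqP /(lev_eq0_le (ltnW ik)) ->.
rewrite minset_sum ?remlev_eq0 //; exact: setltS (remlev_sub _ _) AB.
Qed.

Lemma lev_sum_hi A B h k :
    setlt A B -> lev A h != set0 -> lev A h.+1 = set0 ->
  lev (A :|: B) (h.+1 + k) = lev B k.
Proof.
move=> AB n0 e0; rewrite /lev; congr minset.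
rewrite /remlev addnC iterD -/(remlev _ _) -/(remlev (A :|: B) _) remlev_sum //.
  by move/eqP: e0; rewrite -remlev_eq0 => /eqP ->; rewrite set0U.
move=> i; rewrite ltnS => ih; apply: contra n0 => /eqP /(lev_eq0_le ih) ->.
exact: eqxx.
Qed.

End Levels.

(** * Transport of levels and types along order embeddings *)

Section Embeddings.
Context {d d' : Order.disp_t} {T : finPOrderType d} {T' : finPOrderType d'}.
Variable f : T -> T'.
Implicit Types (A B : {set T}).

Definition emb A := {in A &, forall x y, (f x <= f y)%O = (x <= y)%O}.

Lemma emb_sub A B : B \subset A -> emb A -> emb B.
Proof. by move=> /subsetP s e x y /s xA /s; apply: e. Qed.

Lemma emb_inj A : emb A -> {in A &, injective f}.
Proof.
move=> e x y xA yA fxy; apply/eqP.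
by rewrite eq_le -!e // fxy lexx.
Qed.

Lemma emb_lt A : emb A -> {in A &, forall x y, (f x < f y)%O = (x < y)%O}.
Proof. by move=> e x y xA yA; rewrite !lt_leAnge !e. Qed.

Lemma mem_emb A B : emb A -> B \subset A -> {in A, forall x, (f x \in f @: B) = (x \in B)}.
Proof.
move=> e s x xA; apply/imsetP/idP => [[y yB] E|xB]; last by exists x.
by rewrite (emb_inj e xA (subsetP s _ yB) E).
Qed.

Lemma minset_emb A : emb A -> minset (f @: A) = f @: minset A.
Proof.
move=> e; apply/setP => z; apply/idP/imsetP => [|[x]].
  rewrite inE => /andP[/imsetP[x xA ->] /forall_inP h]; exists x => //.
  rewrite inE xA; apply/forall_inP => y yA.
  by rewrite -(emb_lt e) // h // imset_f.
rewrite inE => /andP[xA /forall_inP h] ->; rewrite inE imset_f //=.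
by apply/forall_inP => _ /imsetP[y yA ->]; rewrite (emb_lt e) // h.
Qed.

Lemma remlev_emb A k : emb A -> remlev (f @: A) k = f @: remlev A k.
Proof.
move=> e; elim: k => // k IH; rewrite !remlevS /lev IH.
rewrite minset_emb; last exact: emb_sub (remlev_sub _ _) e.
apply/setP => z; apply/setDP/imsetP => [[/imsetP[x xA ->]]|[x /setDP[xA xm] ->]].
  by move=> fx; exists x => //; rewrite inE xA andbT; apply: contra fx; exact: imset_f.
split; first exact: imset_f.
rewrite (mem_emb (emb_sub (remlev_sub _ k) e)) //; exact: minset_sub.
Qed.

Lemma lev_emb A k : emb A -> lev (f @: A) k = f @: lev A k.
Proof.
move=> e; rewrite /lev remlev_emb // minset_emb //.
exact: emb_sub (remlev_sub _ _) e.
Qed.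

Lemma height_emb A : emb A -> height (f @: A) = height A.
Proof.
move=> e; rewrite /height card_in_imset; last exact: emb_inj.
by apply: eq_bigl => k; rewrite lev_emb // imset_eq0.
Qed.

Lemma type_mn_emb A m n : emb A -> type_mn A m n -> type_mn (f @: A) m n.
Proof.
move=> e [X] [Y] [XY AE cX cY lt].
have sX : X \subset A by rewrite AE subsetUl.
have sY : Y \subset A by rewrite AE subsetUr.
have inj := emb_inj e.
exists (f @: X), (f @: Y); split.
- apply/setP => z; rewrite !inE; apply/andP => -[/imsetP[x xX ->]].
  rewrite (mem_emb e) ?(subsetP sX) // => xY.
  by have := in_set0 x; rewrite -XY inE xX xY.
- by rewrite AE imsetU.
- by rewrite card_in_imset // => x y /(subsetP sX) xA /(subsetP sX); apply: inj.
- by rewrite card_in_imset // => x y /(subsetP sY) xA /(subsetP sY); apply: inj.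
- move=> _ _ /imsetP[x xA ->] /imsetP[y yA ->].
  by rewrite (emb_lt e) // lt // !(mem_emb e).
Qed.

End Embeddings.

(** * Sections and towers *)

Section EmbeddedSections.
Context {d d' : Order.disp_t} {T : finPOrderType d} {T' : finPOrderType d'}.
Variable f : T -> T'.
Implicit Types (A B : {set T}).

(** [x0] is only the value of the inverse outside the image of [A]. *)
Lemma emb_inverse A (x0 : T) : emb f A ->
  exists g : T' -> T, [/\ emb g (f @: A), g @: (f @: A) = A & {in A, cancel f g}].
Proof.
move=> e; pose g y := odflt x0 [pick x in A | f x == y].
have fK : {in A, cancel f g}.
  move=> x xA; rewrite /g; case: pickP => [y /andP[yA /eqP E]|/(_ x)] /=.
    exact: emb_inj e _ _ yA xA E.
  by rewrite xA eqxx.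
exists g; split=> //.
- by move=> _ _ /imsetP[x xA ->] /imsetP[y yA ->]; rewrite !fK // e.
- rewrite -imset_comp; apply/setP => x; apply/imsetP/idP => [[y yA ->]|xA].
    by rewrite /= fK.
  by exists x; rewrite //= fK.
Qed.

Lemma nice_emb A : emb f A -> nice A -> nice (f @: A).
Proof.
move=> e nA _ _ /imsetP[x xA ->] /imsetP[y yA ->]; rewrite (emb_lt e) // => xy.
have [n1 n2] := nA _ _ xA yA xy; split=> /subsetP s.
- apply: n1; apply/subsetP => z; rewrite !inE => /andP[zA xz].
  by have := s (f z); rewrite !inE imset_f //= (emb_lt e) // e // xz zA => ->.
- apply: n2; apply/subsetP => z; rewrite !inE => /andP[zA xz].
  by have := s (f z); rewrite !inE imset_f //= (emb_lt e) // e // xz zA => ->.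
Qed.

End EmbeddedSections.

Section SectionLevels.
Context {d : Order.disp_t} {T : finPOrderType d}.
Implicit Types (A B : {set T}).

Lemma mem_grid (h : nat) (c : nat -> nat -> T) x :
  reflect (exists k j, [/\ k <= h, j < 3 & x = c k j])
          (x \in \bigcup_(k < h.+1) \bigcup_(j < 3) [set c k j]).
Proof.
apply: (iffP bigcupP) => [[k _ /bigcupP[j _ /set1P->]]|[k [j [kh j3 ->]]]].
  by exists k, j; split=> //; rewrite -ltnS.
exists (Ordinal (kh : k < h.+1)) => //.
by apply/bigcupP; exists (Ordinal j3); rewrite ?inE.
Qed.

(** The row index is a rank: columns provide the predecessors, and a comparability from row [k] to a
    row [l <= k] could be prolonged along the column of its upper end to one inside row [k], which
    is an antichain. *)
Lemma grid_lev A h (c : nat -> nat -> T) :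
    A = \bigcup_(k < h.+1) \bigcup_(j < 3) [set c k j] ->
    (forall k l i j, k <= h -> l <= h -> i < 3 -> j < 3 ->
       c k i = c l j -> k = l /\ i = j) ->
    (forall k j, k < h -> j < 3 -> (c k j < c k.+1 j)%O) ->
    (forall k i j, k <= h -> i < 3 -> j < 3 -> ~~ (c k i < c k j)%O) ->
  [/\ forall k j, k <= h -> j < 3 -> c k j \in A,
      forall k l i j, k <= h -> l <= h -> i < 3 -> j < 3 ->
        (c k i < c l j)%O -> k < l,
      forall k, k <= h -> lev A k = [set c k 0; c k 1; c k 2],
      forall k, k <= h -> #|lev A k| = 3 &
      forall k, h < k -> lev A k = set0].
Proof.
move=> AE inj chain anti.
have mem k j : k <= h -> j < 3 -> c k j \in A.
  by move=> kh j3; rewrite AE; apply/mem_grid; exists k, j.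
have col k l j : k <= l -> l <= h -> j < 3 -> (c k j <= c l j)%O.
  move=> /subnKC <-; elim: (l - k) => [|n IH]; first by rewrite addn0 lexx.
  rewrite addnS => nh j3; apply: le_trans (IH (ltnW nh) j3) (ltW _).
  exact: chain.
have mono k l i j : k <= h -> l <= h -> i < 3 -> j < 3 ->
    (c k i < c l j)%O -> k < l.
  move=> kh lh i3 j3 lt; rewrite ltnNge; apply/negP => lk.
  have := anti k i j kh i3 j3; rewrite (lt_le_trans lt) //; exact: col.
pose rk x := if [pick p : 'I_h.+1 * 'I_3 | x == c p.1 p.2] is Some p
             then (p.1 : nat) else 0.
have rkE k j : k <= h -> j < 3 -> rk (c k j) = k.
  move=> kh j3; rewrite /rk; case: pickP => [[k' j'] /= /eqP E|].
    by have [] := inj _ _ _ _ kh (ltn_ord k') j3 (ltn_ord j') E.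
  by move/(_ (Ordinal (kh : k < h.+1), Ordinal j3)); rewrite /= eqxx.
have levE : forall k, lev A k = [set x in A | rk x == k].
  apply: ranked_lev => [x y|x]; rewrite AE.
    move=> /mem_grid[k [i [kh i3 ->]]] /mem_grid[l [j [lh j3 ->]]].
    by rewrite !rkE //; apply: mono.
  move=> /mem_grid[[|k] [i [kh i3 ->]]]; rewrite !rkE // => _.
  exists (c k i); first by rewrite -AE mem // ltnW.
  by rewrite chain // rkE // ltnW.
have levc k : k <= h -> lev A k = [set c k 0; c k 1; c k 2].
  move=> kh; apply/setP => x; rewrite levE !inE; apply/andP/idP.
    rewrite {1}AE => -[/mem_grid[l [j [lh j3 ->]]]]; rewrite rkE // => /eqP ->.
    by case: j j3 => [|[|[]]] //= _; rewrite eqxx ?orbT.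
  by move=> /orP[/orP[]|] /eqP ->; rewrite mem ?rkE.
split=> // k kh.
  rewrite levc // -setUA cardsU1 cards2 !inE.
  by do 3! (case: eqP => [/inj[] //|_]).
apply/setP => x; rewrite levE !inE; apply/andP => -[].
by rewrite {1}AE => /mem_grid[l [j [lh j3 ->]]]; rewrite rkE // => /eqP; lia.
Qed.

Lemma section3_lev A : section3 A ->
  [/\ forall k, k <= height A -> #|lev A k| = 3 & lev A (height A).+1 = set0].
Proof.
case=> h [c [[h1 hE AE] [inj chain anti _ _]]].
have [_ _ _ c3 e0] := grid_lev AE inj chain anti.
by rewrite -hE; split=> //; apply: e0.
Qed.

End SectionLevels.

Section EmbeddedTowers.
Context {d d' : Order.disp_t} {T : finPOrderType d} {T' : finPOrderType d'}.
Variable f : T -> T'.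
Implicit Types (A B : {set T}).

Lemma section3_emb A : emb f A -> section3 A -> section3 (f @: A).
Proof.
move=> e [h [c [[h1 hE AE] [inj chain anti cyc n33]]]].
have [mem _ _ _ _] := grid_lev AE inj chain anti.
exists h, (fun k j => f (c k j)); split; split=> //.
- by rewrite height_emb.
- apply/setP => y; apply/imsetP/(mem_grid _ (fun k j => f (c k j))) => [[x]|].
    by rewrite {1}AE => /mem_grid[k [j [kh j3 ->]]] ->; exists k, j.
  by case=> k [j [kh j3 ->]]; exists (c k j); rewrite ?mem.
- move=> k l i j kh lh i3 j3 E; apply: inj => //.
  by apply: (emb_inj e) E; apply: mem.
- by move=> k j kh j3; rewrite (emb_lt e) ?mem ?chain // ltnW.
- by move=> k i j kh i3 j3; rewrite (emb_lt e) ?mem ?anti.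
- move=> k l i j kh lh i3 j3; rewrite !(emb_lt e) ?mem ?ltn_mod //.
  exact: cyc.
- move=> k kh; rewrite !lev_emb // -imsetU => t33; apply: (n33 k kh).
  have [g [ge gf fK]] := emb_inverse (c 0 0) e.
  have sub : f @: (lev A k :|: lev A k.+1) \subset f @: A.
    by apply: imsetS; rewrite subUset !lev_sub.
  have := type_mn_emb (emb_sub sub ge) t33.
  (* Pulling a type 33 pair back along the inverse embedding contradicts the hypothesis on [A]. *)
  rewrite -imset_comp (_ : [set _ | x in _] = lev A k :|: lev A k.+1) //.
  rewrite -[RHS]imset_id; apply: eq_in_imset => x xl; apply: fK.
  by apply: subsetP xl; rewrite subUset !lev_sub.
Qed.

Lemma nice_section_emb A : emb f A -> nice_section A -> nice_section (f @: A).
Proof.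
move=> e [sA nA]; split; last exact: nice_emb.
case: sA => [[x [y [xy AE nxy nyx]]]|s3]; last by right; apply: section3_emb.
have xA : x \in A by rewrite AE !inE eqxx.
have yA : y \in A by rewrite AE !inE eqxx orbT.
left; exists (f x), (f y); split.
- by rewrite (inj_in_eq (emb_inj e)).
- by rewrite AE imsetU !imset_set1.
- by rewrite (emb_lt e).
- by rewrite (emb_lt e).
Qed.

End EmbeddedTowers.

(** * Towers as lists of sections *)

Section Towers.
Context {d : Order.disp_t} {T : finPOrderType d}.
Implicit Types (A B : {set T}) (s : seq {set T}).

Definition usum s : {set T} := \bigcup_(B <- s) B.

Lemma usum_cons B s : usum (B :: s) = B :|: usum s.
Proof. exact: big_cons. Qed.

Lemma mem_usum s x : reflect (exists2 B, B \in s & x \in B) (x \in usum s).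
Proof.
elim: s => [|B s IH]; first by rewrite /usum big_nil inE; right => -[].
rewrite usum_cons inE; apply: (iffP orP) => [[xB|/IH[C Cs xC]]|[C]].
- by exists B; rewrite ?mem_head.
- by exists C; rewrite // inE Cs orbT.
- by rewrite inE => /orP[/eqP ->|Cs] xC; [left|right; apply/IH; exists C].
Qed.

Lemma usum_cat s1 s2 : usum (s1 ++ s2) = usum s1 :|: usum s2.
Proof. exact: big_cat. Qed.

(** Recursive counterpart of [tower_nice]; comparing a section with the union of all later ones
    makes induction and cutting of towers direct. *)
Fixpoint tower s : Prop :=
  if s is B :: s' then [/\ nice_section B, setlt B (usum s') & tower s'] else True.

Lemma tower_niceP A :
  tower_nice A <-> exists s, [/\ s != [::], A = usum s & tower s].
Proof.
split=> -[s].
  case=> s0 AE ns lt; exists s; split=> //.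
  elim: s {AE s0} ns lt => //= B s IH ns lt; split.
  - by apply: ns; rewrite mem_head.
  - move=> x y xB /mem_usum[C /(nthP set0)[i si <-]] yC.
    exact: (lt 0 i.+1).
  - apply: IH => [C Cs|i j ij js]; first by apply: ns; rewrite inE Cs orbT.
    exact: (lt i.+1 j.+1).
case=> s0 AE ts; exists s; split=> //.
  elim: s {AE s0} ts => // B s IH /= [nB _ ts] C.
  by rewrite inE => /orP[/eqP->|] //; apply: IH.
elim: s {AE s0} ts => // B s IH /= [nB lt ts] [|i] [|j] //= ij js.
  move=> x y xB yj; apply: lt => //; apply/mem_usum.
  by exists (nth set0 s j); rewrite ?mem_nth.
exact: IH.
Qed.

Lemma tower_cat s1 s2 :
  tower (s1 ++ s2) <-> [/\ tower s1, tower s2 & setlt (usum s1) (usum s2)].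
Proof.
elim: s1 => [|B s1 IH] /=.
  split=> [t2|[]//]; split=> // x y; rewrite /usum big_nil inE //.
split=> [[nB lt /IH[t1 t2 lt12]]|[[nB lt t1] t2 lt12]].
  split=> //.
    by split=> // x y xB ys; apply: lt => //; rewrite usum_cat inE ys.
  move=> x y; rewrite usum_cons inE => /orP[xB|]; last exact: lt12.
  by move=> y2; apply: lt => //; rewrite usum_cat inE y2 orbT.
split=> //.
  move=> x y xB; rewrite usum_cat inE => /orP[|y2]; first exact: lt.
  by apply: lt12; rewrite // usum_cons inE xB.
apply/IH; split=> // x y x1; apply: lt12; by rewrite usum_cons inE x1 orbT.
Qed.

Lemma antichain2_lev (x y : T) : x != y -> ~~ (x < y)%O -> ~~ (y < x)%O ->
  lev [set x; y] 0 = [set x; y] /\ lev [set x; y] 1 = set0.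
Proof.
move=> xy nxy nyx.
suff E k : lev [set x; y] k = [set z in [set x; y] | 0 == k].
  by rewrite !E; split; apply/setP => z; rewrite !inE ?andbT ?andbF.
apply: (@ranked_lev _ _ _ (fun=> 0)) => // a b; rewrite !inE.
by do 2! case/orP => /eqP ->; rewrite ?ltxx // ?(negPf nxy) ?(negPf nyx).
Qed.

Lemma nice_section_lev B : nice_section B ->
  lev B (height B).+1 = set0 /\
  (section3 B /\ (forall k, k <= height B -> #|lev B k| = 3) \/
   [/\ height B = 0, lev B 0 = B, #|B| = 2 &
    exists x y, [/\ x != y, B = [set x; y], ~~ (x < y)%O & ~~ (y < x)%O]]).
Proof.
case=> -[[x [y [xy BE nxy nyx]]]|s3] _; last first.
  by have [c3 e0] := section3_lev s3; split=> //; left.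
have [l0 l1] := antichain2_lev xy nxy nyx.
have h0 : height B = 0.
  by rewrite BE; apply: height_eq => //; rewrite l0 -card_gt0 cards2.
rewrite h0; split; first by rewrite BE.
by right; split; rewrite ?BE ?cards2 ?xy //; exists x, y.
Qed.

Lemma nice_section_lev_top B : nice_section B -> lev B (height B) != set0.
Proof.
move=> nB; have [_ [[_ c3]|[-> -> c2 _]]] := nice_section_lev nB.
  by rewrite -card_gt0 c3.
by rewrite -card_gt0 c2.
Qed.

Lemma tower_lev B s k : tower (B :: s) ->
  lev (usum (B :: s)) k =
    if k <= height B then lev B k else lev (usum s) (k - (height B).+1).
Proof.
case=> nB lt _; rewrite usum_cons.
have top := nice_section_lev_top nB; have [e0 _] := nice_section_lev nB.
case: leqP => [kh|hk].
  rewrite lev_sum_lo //; apply: contra top => /eqP /(lev_eq0_le kh) ->.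
  exact: eqxx.
by rewrite -{1}(subnKC hk) lev_sum_hi.
Qed.

Lemma lev_set0 k : lev (set0 : {set T}) k = set0.
Proof. by apply/eqP; rewrite -subset0 lev_sub. Qed.

Lemma tower_lev0 s : tower s -> s != [::] ->
  lev (usum s) 0 = lev (head set0 s) 0 /\ 1 < #|lev (usum s) 0|.
Proof.
case: s => // B s t _; rewrite tower_lev //=; split=> //.
by case: t => /nice_section_lev[_ [[_ ->]|[_ -> ->]]].
Qed.

Lemma lev_anti A k : {in lev A k &, forall x y, ~~ (x < y)%O}.
Proof.
by move=> x y; rewrite /lev !inE => /andP[xk _] /andP[_ /forall_inP]; apply.
Qed.

Lemma type_mn_sum A B :
    {in A &, forall x y, ~~ (x < y)%O} -> {in B &, forall x y, ~~ (x < y)%O} ->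
  setlt A B -> type_mn (A :|: B) #|A| #|B|.
Proof.
move=> aA aB lt; exists A, B; split=> //; first exact: setlt_disj.
have dis x : x \in A -> x \in B -> False.
  by move=> xA xB; have := lt _ _ xA xB; rewrite ltxx.
move=> x y; rewrite !in_setU => /orP[] xI /orP[] yI.
- have -> : y \in B = false by apply/negP; apply: dis.
  by rewrite andbF; apply/negbTE/aA.
- by rewrite xI yI lt.
- have -> : y \in B = false by apply/negP; apply: dis.
  by rewrite andbF; apply/negP => /(lt_trans (lt _ _ yI xI)); rewrite ltxx.
- have -> : x \in A = false by apply/negP => /dis; apply.
  exact/negbTE/aB.
Qed.

(** [type_mn] only asserts that some decomposition exists, so its lower part [X] has to be
    identified with the lower level. An element of that level lying in [Y] would be above some
    element of [X], hence above an element of its own level. *)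
Lemma type_mn_lev A l m n : 0 < m -> 0 < n ->
  type_mn (lev A l :|: lev A l.+1) m n -> #|lev A l| = m /\ #|lev A l.+1| = n.
Proof.
move=> m0 n0 [X [Y [XY AE cX cY lt]]].
have anti := @lev_anti A.
have XUY x : (x \in lev A l) || (x \in lev A l.+1) = (x \in X) || (x \in Y).
  by rewrite -!in_setU AE.
have lt' x y : x \in X -> y \in Y -> (x < y)%O.
  by move=> xX yY; rewrite lt ?AE ?inE ?xX ?yY ?orbT.
have lev1 x : x \in lev A l.+1 -> exists2 y, y \in lev A l & (y < x)%O.
  rewrite {1}/lev inE => /andP[]; rewrite remlevS inE => /andP[xl xr] _.
  move: xl; rewrite {1}/lev inE xr negb_forall => /existsP[y].
  rewrite negb_imply negbK => /andP[yr yx].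
  (* Among the remaining elements below [y], one with the fewest predecessors is minimal and so lies
     on level [l]. *)
  case: (arg_minnP (P := fun z => (z \in remlev A l) && (z <= y)%O) (i0 := y)
           (fun z => #|[set u | (u < z)%O]|)); first by rewrite yr lexx.
  move=> z /andP[zr zy] zmin; exists z; last exact: le_lt_trans zy yx.
  rewrite /lev inE zr; apply/forall_inP => u ur; apply/negP => uz.
  have := zmin u; rewrite ur (le_trans (ltW uz) zy) => /(_ isT).
  rewrite leqNgt => /negP; apply; apply: proper_card; apply/properP; split.
    by apply/subsetP => v; rewrite !inE => /lt_trans; apply.
  by exists u; rewrite !inE ?ltxx.
have XE : lev A l = X.
  apply/setP => x; apply/idP/idP => [xl|xX].
    have := XUY x; rewrite xl /= => /esym /orP[//|xY].
    have [z zX] : exists z, z \in X by apply/set0Pn; rewrite -card_gt0 cX.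
    have := XUY z; rewrite zX /= => /orP[zl|/lev1[u ul uz]].
      by have := anti _ _ _ zl xl; rewrite lt'.
    by have := anti _ _ _ ul xl; rewrite (lt_trans uz) // lt'.
  have := XUY x; rewrite xX /= => /orP[//|/lev1[u ul ux]].
  have : (u \in X) || (u \in Y) by rewrite -XUY ul.
  have xlu : x \in lev A l :|: lev A l.+1 by rewrite AE inE xX.
  have ulu : u \in lev A l :|: lev A l.+1 by rewrite inE ul.
  move: ux; rewrite lt // => /andP[_ xY].
  by have := in_set0 x; rewrite -XY inE xX xY.
have dis : lev A l :&: lev A l.+1 = set0.
  apply/setP => x; rewrite in_setI in_set0; apply/negP => /andP[xl xl1].
  have := subsetP (minset_sub (remlev A l.+1)) x xl1.
  by rewrite remlevS in_setD xl.
split; first by rewrite XE.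
rewrite -cY; congr #|pred_of_set _|; apply/setP => x.
have := XUY x; have := in_set0 x; rewrite -{1}dis; have := in_set0 x.
rewrite -{1}XY !in_setI XE.
by case: (x \in X); case: (x \in Y); case: (x \in lev A l.+1).
Qed.

(** All levels of one section have the same size, so a drop from 3 to 2 can only happen where a
    section of width three is followed by a 2-antichain. *)
Lemma tower32_split (s : seq {set T}) l : tower s ->
    #|lev (usum s) l| = 3 -> #|lev (usum s) l.+1| = 2 ->
  exists (s1 s2 : seq {set T}) (B Y : {set T}),
    [/\ s = s1 ++ B :: Y :: s2, section3 B & #|Y| = 2].
Proof.
elim: s l => [|B s IH] l t; first by rewrite /usum big_nil lev_set0 cards0.
have [nB _ ts] := t; rewrite !(tower_lev _ t).
have [_ [[s3 c3]|[h0 l0 c2 _]]] := nice_section_lev nB; last first.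
  rewrite h0; case: l => [|l]; first by rewrite l0 c2.
  rewrite !ltn0 !subn1 /= => e3 e2.
  by have [s1 [s2 [B' [Y [-> ? ?]]]]] := IH l ts e3 e2; exists (B :: s1), s2, B', Y.
have [lh|hl] := leqP l (height B); last first.
  rewrite leqNgt ltnS (ltnW hl) /= subSn // => e3 e2.
  by have [s1 [s2 [B' [Y [-> ? ?]]]]] := IH _ ts e3 e2; exists (B :: s1), s2, B', Y.
move=> _; case: ltnP => [lh1|]; first by rewrite c3.
move=> hl; have -> : l.+1 - (height B).+1 = 0 by lia.
case: s ts t {IH} => [|Y s] ts t; first by rewrite /usum big_nil lev_set0 cards0.
have [nY _ _] := ts; have [-> _] := tower_lev0 (ts : tower (Y :: s)) isT; rewrite /= => e2.
exists [::], s, B, Y; split=> //.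
by have [_ [[_ cY]|[_ <- //]]] := nice_section_lev nY; rewrite cY in e2.
Qed.

Lemma section2 (Y : {set T}) : nice_section Y -> #|Y| = 2 -> exists a b : T,
  [/\ Y = [set a; b], a != b, ~~ (a < b)%O & ~~ (b < a)%O].
Proof.
move=> nY c2; have [_ [[s3 c3]|[_ _ _ [a [b [ab -> ? ?]]]]]] := nice_section_lev nY.
  have := c3 0 (leq0n _); have := subset_leq_card (lev_sub Y 0).
  by rewrite c2 => l2 e3; rewrite e3 in l2.
by exists a, b.
Qed.

Lemma section2_lev (Y : {set T}) : nice_section Y -> #|Y| = 2 ->
  height Y = 0 /\ lev Y 0 = Y.
Proof.
move=> nY cY; have [_ [[_ c3]|[-> -> //]]] := nice_section_lev nY.
by have := subset_leq_card (lev_sub Y 0); rewrite cY c3.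
Qed.

End Towers.

Lemma tower_emb d d' (T : finPOrderType d) (T' : finPOrderType d') (f : T -> T') (s : seq {set T}) :
  emb f (usum s) -> tower s -> tower [seq f @: (B : {set T}) | B <- s].
Proof.
elim: s => //= B s IH e [nB lt t].
have sB : B \subset usum (B :: s) by rewrite usum_cons subsetUl.
have ss : usum s \subset usum (B :: s) by rewrite usum_cons subsetUr.
split; last exact: IH (emb_sub ss e) t.
  exact: nice_section_emb (emb_sub sB e) nB.
move=> _ y /imsetP[x xB ->] /mem_usum[_ /mapP[C Cs ->] /imsetP[z zC ->]].
have zs : z \in usum s by apply/mem_usum; exists C.
rewrite (emb_lt e); [exact: lt|exact: (subsetP sB)|exact: (subsetP ss)].
Qed.

Lemma usum_emb d d' (T : finPOrderType d) (T' : finPOrderType d') (f : T -> T')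
  (s : seq {set T}) : usum [seq f @: (B : {set T}) | B <- s] = f @: usum s.
Proof.
by elim: s => [|B s IH]; rewrite ?usum_cons /= ?usum_cons ?IH ?imsetU // /usum !big_nil imset0.
Qed.

Lemma tower_nice_emb d d' (T : finPOrderType d) (T' : finPOrderType d')
  (f : T -> T') (A : {set T}) : emb f A -> tower_nice A -> tower_nice (f @: A).
Proof.
move=> e /tower_niceP[s [s0 AE t]]; apply/tower_niceP.
exists [seq f @: (B : {set T}) | B <- s]; rewrite usum_emb AE; split=> //.
  by case: (s) s0.
by apply: tower_emb; rewrite -?AE.
Qed.

(** * Posets described by words *)

Lemma third_colour (i j : 'I_3) : exists k : 'I_3, k != i /\ k != j.
Proof.
have /card_gt0P[k] : 0 < #|~: [set i; j]|.
  have := cardsC [set i; j]; rewrite card_ord cards2.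
  by case: (i != j); move: #|_| => n; lia.
by rewrite !inE negb_or => /andP[]; exists k.
Qed.

Lemma inord_eq3 i j : i < 3 -> j < 3 -> (inord i == inord j :> 'I_3) = (i == j).
Proof. by move=> i3 j3; rewrite -val_eqE /= !inordK. Qed.

Definition colour1 : 'I_3 := inord 1.
Definition colour2 : 'I_3 := inord 2.

Lemma I3P (i : 'I_3) : [\/ i = ord0, i = colour1 | i = colour2].
Proof.
case: i => [[|[|[|n]]] p] //.
- by apply: Or31; apply/val_inj.
- by apply: Or32; apply/val_inj; rewrite /= inordK.
- by apply: Or33; apply/val_inj; rewrite /= inordK.
Qed.

Lemma I3_eq : (((ord0 == colour1) = false) * ((ord0 == colour2) = false) *
  ((colour1 == colour2) = false) * ((colour1 == ord0) = false) * ((colour2 == ord0) = false) *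
  ((colour2 == colour1) = false))%type.
Proof. by rewrite -!val_eqE /= !inordK. Qed.

Lemma colour_unique (i j k l : 'I_3) : i != j -> k != i -> k != j ->
  l != i -> l != j -> k = l.
Proof.
case: (I3P i) => ->; case: (I3P j) => ->; rewrite ?eqxx //;
case: (I3P k) => ->; rewrite ?eqxx //; case: (I3P l) => ->; by rewrite ?eqxx.
Qed.

(* [true] stands for a 6-crown, with colours normalized so that an element is
   incomparable exactly to the element of the same colour on the next level. *)
Definition wlt (w : nat -> bool) k (i : 'I_3) l (j : 'I_3) : bool :=
  (k.+1 < l) || (l == k.+1) && (if w k then i != j else i == j).

Lemma wlt_ltn w k i l j : wlt w k i l j -> k < l.
Proof. by case/orP => [/ltnW|/andP[/eqP ->]]. Qed.

Section Words.
Context {d : Order.disp_t} {T : finPOrderType d}.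
Implicit Types (A B : {set T}).

(** Coordinates for [A]: [lv] and [co] invert [c], and the order is read off from the letters
    [w 0, ..., w (h - 1)], so that comparisons become statements about levels and colours. *)
Record word_structure A (h : nat) (w : nat -> bool) (c : nat -> 'I_3 -> T)
    (lv : T -> nat) (co : T -> 'I_3) : Prop := Wst {
  w_in : forall k i, k <= h -> c k i \in A;
  w_lv : forall k i, k <= h -> lv (c k i) = k;
  w_co : forall k i, k <= h -> co (c k i) = i;
  w_c : {in A, forall x, c (lv x) (co x) = x};
  w_le : {in A, forall x, lv x <= h};
  w_lt : {in A &, forall x y, (x < y)%O = wlt w (lv x) (co x) (lv y) (co y)} }.

Definition word A h w := exists c lv co, word_structure A h w c lv co.

Lemma word_intro A h w (c : nat -> 'I_3 -> T) :
    (forall k i, k <= h -> c k i \in A) ->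
    {in A, forall x, exists k i, k <= h /\ x = c k i} ->
    (forall k l i j, k <= h -> l <= h -> c k i = c l j -> k = l /\ i = j) ->
    (forall k l i j, k <= h -> l <= h -> (c k i < c l j)%O = wlt w k i l j) ->
  word A h w.
Proof.
move=> cA onto inj lt.
pose pk x := [pick p : 'I_h.+1 * 'I_3 | x == c p.1 p.2].
pose lv x := if pk x is Some p then (p.1 : nat) else 0.
pose co x := if pk x is Some p then p.2 else ord0.
have E k i : k <= h -> lv (c k i) = k /\ co (c k i) = i.
  move=> kh; rewrite /lv /co /pk; case: pickP => [p /= /eqP E|].
    by have [] := inj _ _ _ _ kh (ltn_ord p.1) E.
  by move/(_ (Ordinal (kh : k < h.+1), i)); rewrite /= eqxx.
exists c, lv, co; split=> //.
- by move=> k i /(E k i)[].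
- by move=> k i /(E k i)[].
- by move=> x /onto[k [i [kh ->]]]; have [-> ->] := E k i kh.
- by move=> x /onto[k [i [kh ->]]]; have [-> _] := E k i kh.
- move=> x y /onto[k [i [kh ->]]] /onto[l [j [lh ->]]].
  by have [-> ->] := E k i kh; have [-> ->] := E l j lh; apply: lt.
Qed.

Section Structure.
Variables (A : {set T}) (h : nat) (w : nat -> bool).
Variables (c : nat -> 'I_3 -> T) (lv : T -> nat) (co : T -> 'I_3).
Hypothesis W : word_structure A h w c lv co.

Lemma wst_c_lt k i l j : k <= h -> l <= h -> (c k i < c l j)%O = wlt w k i l j.
Proof. by move=> kh lh; rewrite (w_lt W) ?(w_in W) // !(w_lv W) // !(w_co W). Qed.

Lemma wst_lev k : lev A k = [set x in A | lv x == k].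
Proof.
apply: ranked_lev => [x y xA yA|x xA x0].
  by rewrite (w_lt W) // => /wlt_ltn.
have xh := w_le W xA; pose l := (lv x).-1.
have lS : l.+1 = lv x by rewrite prednK.
have lh : l <= h by rewrite (leq_trans _ xh) // -lS.
have [i wi] : exists i, if w l then i != co x else i == co x.
  case: (w l); last by exists (co x).
  by have [i [ix _]] := third_colour (co x) (co x); exists i.
exists (c l i); first exact: w_in W _ _ lh.
rewrite (w_lt W) ?(w_in W) // (w_lv W) // (w_co W) // /wlt -lS eqxx ltnn.
by case: (w l) wi.
Qed.

Lemma wst_levE k : k <= h -> lev A k = [set c k i | i : 'I_3].
Proof.
move=> kh; rewrite wst_lev; apply/setP => x; rewrite inE.
apply/andP/imsetP => [[xA /eqP <-]|[i _ ->]].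
  by exists (co x); rewrite ?(w_c W).
by rewrite (w_in W) ?(w_lv W).
Qed.

Lemma wst_height : height A = h.
Proof.
apply: height_eq; rewrite wst_lev.
  by apply/set0Pn; exists (c h ord0); rewrite inE (w_in W) ?(w_lv W) ?eqxx.
apply/setP => x; rewrite !inE; apply/andP => -[xA /eqP e].
by have := w_le W xA; rewrite e ltnn.
Qed.

Lemma wst_seg k l : seg A k l = [set x in A | k <= lv x <= l].
Proof.
apply/setP => x; rewrite /seg; apply/idP/idP.
  rewrite big_nat_cond; elim/big_rec: _ => [|i B /andP[/andP[ki il] _] IH].
    by rewrite in_set0.
  rewrite in_setU => /orP[|//]; rewrite wst_lev inE => /andP[xA /eqP xi].
  by rewrite inE xA xi ki -ltnS.
rewrite inE => /and3P[xA kx xl].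
rewrite (bigD1_seq (lv x)) ?mem_index_iota ?iota_uniq ?ltnS ?kx //=.
by rewrite in_setU wst_lev inE xA eqxx.
Qed.

Lemma wst_interval k l : k <= l -> l <= h ->
  word_structure [set x in A | k <= lv x <= l] (l - k) (fun i => w (k + i))
      (fun i => c (k + i)) (fun x => lv x - k) co.
Proof.
move=> kl lh; split.
- move=> i j ij; have kih : k + i <= h by lia.
  by rewrite inE (w_in W) ?(w_lv W) //=; lia.
- by move=> i j ij; rewrite (w_lv W); lia.
- by move=> i j ij; rewrite (w_co W) //; lia.
- by move=> x; rewrite inE => /and3P[xA kx xl]; rewrite subnKC ?(w_c W).
- by move=> x; rewrite inE => /and3P[xA kx xl]; lia.
- move=> x y; rewrite !inE => /and3P[xA kx xl] /and3P[yA ky yl].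
  rewrite (w_lt W) //; move: (lv x) (lv y) kx ky {xl yl}.
  move=> p q /subnKC <- /subnKC <-; rewrite !addKn /wlt -!addnS.
  by rewrite leq_add2l eqn_add2l.
Qed.

(** Describes the letter without coordinates: only in a crown does an element have two upper
    neighbours on the next level. Hence the letters do not depend on the chosen structure. *)
Lemma wst_word_char k : k < h ->
  w k <-> exists x y z, [/\ x \in lev A k, y \in lev A k.+1, z \in lev A k.+1,
                          y != z & (x < y)%O /\ (x < z)%O].
Proof.
move=> kh; rewrite !wst_lev; split=> [wk|[x [y [z []]]]].
  have [i [i0 _]] := third_colour ord0 ord0.
  have [j [j0 ji]] := third_colour ord0 i.
  exists (c k ord0), (c k.+1 i), (c k.+1 j).
  rewrite !inE !(w_in W) ?(w_lv W) ?wst_c_lt // 1?ltnW // !eqxx; split=> //.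
    by apply: contra ji => /eqP /(congr1 co); rewrite !(w_co W) // => ->.
  by rewrite /wlt wk eqxx !(eq_sym ord0) i0 j0 orbT.
rewrite !inE => /andP[xA /eqP xk] /andP[yA /eqP yk] /andP[zA /eqP zk] yz.
rewrite !(w_lt W) // xk yk zk /wlt eqxx ltnn /=; case: (w k) => //= -[].
move=> /eqP xy /eqP xz; case/eqP: yz.
by rewrite -(w_c W yA) -(w_c W zA) yk zk -xy xz.
Qed.

Lemma wst_up k i : k < h -> exists j, (c k i < c k.+1 j)%O.
Proof.
move=> kh; have [j [ji _]] := third_colour i i; exists (if w k then j else i).
rewrite wst_c_lt // 1?ltnW // /wlt ltnn eqxx /=.
by case: (w k); rewrite ?eqxx // eq_sym.
Qed.

Lemma wst_down k j : k < h -> exists i, (c k i < c k.+1 j)%O.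
Proof.
move=> kh; have [i [ij _]] := third_colour j j; exists (if w k then i else j).
rewrite wst_c_lt // 1?ltnW // /wlt ltnn eqxx /=.
by case: (w k); rewrite ?eqxx.
Qed.

(** Every lower element has an upper neighbour and conversely, so the two parts of a type 33
    decomposition would be the two levels; but either letter leaves an incomparable pair. *)
Lemma wst_not33 k : k < h -> ~ type_mn (lev A k :|: lev A k.+1) 3 3.
Proof.
move=> kh [X [Y [XY AE _ _ lt]]]; have kh' := ltnW kh.
have lo i : c k i \in lev A k :|: lev A k.+1.
  by rewrite in_setU wst_levE // imset_f.
have hi i : c k.+1 i \in lev A k :|: lev A k.+1.
  by rewrite in_setU (wst_levE kh) imset_f ?orbT.
have all i j : (c k i < c k.+1 j)%O.
  have [j' /[dup] ij'] := wst_up i kh; rewrite lt // => /andP[iX _].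
  have [i' /[dup] i'j] := wst_down j kh; rewrite lt // => /andP[_ jY].
  by rewrite lt // iX jY.
have [j [j0 _]] := third_colour ord0 ord0.
have := all ord0 j; have := all ord0 ord0.
by rewrite !wst_c_lt // /wlt ltnn !eqxx /= (eq_sym ord0 j) (negPf j0); case: (w k).
Qed.

(* Rotating the colours once after each crown turns [i != j] into a relation
   containing the diagonal. *)
Fixpoint turn k := if k is k'.+1 then turn k' + w k' else 0.

Lemma wst_section3 : 0 < h -> section3 A.
Proof.
move=> h0; pose e k j : 'I_3 := inord ((j + turn k) %% 3).
have eE k i l j : (e k i == e l j) = ((i + turn k) %% 3 == (j + turn l) %% 3).
  by rewrite inord_eq3 ?ltn_mod.
exists h, (fun k j => c k (e k j)); split; split=> //.
- by rewrite wst_height.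
- apply/setP => x; apply/idP/(mem_grid _ (fun k j => c k (e k j))).
    (* Modulo 3, adding [2 * turn] undoes the rotation by [turn]. *)
    move=> xA; exists (lv x), ((co x + 2 * turn (lv x)) %% 3).
    rewrite (w_le W) // ltn_mod; split=> //.
    rewrite -[LHS](w_c W) //; congr c; apply/val_inj; rewrite /= inordK ?ltn_mod //.
    by have := ltn_ord (co x); lia.
  by move=> [k [j [kh _ ->]]]; rewrite (w_in W).
- move=> k l i j kh lh i3 j3 E.
  have /= := congr1 lv E; rewrite !(w_lv W) // => kl; split=> //.
  have /= := congr1 co E; rewrite !(w_co W) // => /eqP; rewrite eE kl => /eqP.
  by lia.
- move=> k j kh j3; rewrite wst_c_lt // 1?ltnW // /wlt eqxx eE /=.
  by case: (w k); lia.
- by move=> k i j kh i3 j3; rewrite wst_c_lt // /wlt ltnNge leqnSn eqn_leq ltnn andbF.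
- move=> k l i j kh lh i3 j3; rewrite !wst_c_lt // => /orP[kl|/andP[kl]].
    by rewrite /wlt kl.
  by rewrite /wlt kl !eE /=; case: (w k); lia.
- exact: wst_not33.
Qed.

(** For [x < y] an upper neighbour of [x] different from [y] usually serves as witness. It is
    missing only if [y] is the single upper neighbour of [x] in a 3C; then the top crown guarantees
    one more level, which contains an element above [x] but not above [y]. The second half is dual
    and uses the bottom crown. *)
Lemma wst_nice : 0 < h -> w 0 -> w h.-1 -> nice A.
Proof.
move=> h0 w0 wh x y xA yA; rewrite (w_lt W) // => xy.
have xh := w_le W xA; have yh := w_le W yA; have xly := wlt_ltn xy.
split=> /subsetP s.
  have xh' : lv x < h := leq_trans xly yh.
  have xh2 := ltnW xh'.
  have [j [jx jy]] := third_colour (co x) (co y).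
  have [z zA [xz yz]] : exists2 z, z \in A & (x < z)%O /\ ~~ (y <= z)%O.
    pose j' := if w (lv x) then j else co x.
    have [/andP[/eqP yx1 e]|ne] :=
      boolP ((lv y == (lv x).+1) && (co y == j')); last first.
      exists (c (lv x).+1 j'); first exact: w_in W _ _ xh'.
      rewrite le_eqVlt !(w_lt W) ?(w_in W) // !(w_lv W) // (w_co W) //; split.
        by rewrite /wlt eqxx ltnn /j'; case: (w (lv x)); rewrite ?eqxx // eq_sym.
      rewrite negb_or; apply/andP; split.
        apply: contra ne => /eqP ->.
        by rewrite (w_lv W) // (w_co W) // !eqxx.
      apply/negP => /wlt_ltn; lia.
    move: e; rewrite /j'; case: ifP => wx /eqP e.
      by rewrite e eqxx in jy.
    have xh3 : (lv x).+2 <= h.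
      rewrite ltn_neqAle xh' andbT; by apply: contraFN wx => /eqP xe; move: wh; rewrite -xe.
    have [j2 [j2y _]] := third_colour (co y) (co y).
    (* The colour of an element just above the level of [y] that is incomparable to [y]. *)
    pose j3 := if w (lv y) then co y else j2.
    exists (c (lv x).+2 j3); first exact: w_in W _ _ xh3.
    rewrite le_eqVlt !(w_lt W) ?(w_in W) // !(w_lv W) // (w_co W) //; split.
      by rewrite /wlt ltnSn.
    rewrite negb_or; apply/andP; split.
      by apply/negP => /eqP /(congr1 lv); rewrite (w_lv W) // yx1; lia.
    rewrite /wlt yx1 ltnn eqxx /=; rewrite /j3 yx1; case: (w _); rewrite ?eqxx //.
    by rewrite eq_sym.
  by have := s z; rewrite !inE zA xz (negPf yz) => /(_ isT).
have y0 : 0 < lv y := leq_ltn_trans (leq0n _) xly.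
pose k := (lv y).-1; have kS : k.+1 = lv y by rewrite prednK.
have kh : k < h by rewrite kS.
have kh1 := ltnW kh.
have [j [jy jx]] := third_colour (co y) (co x).
have [z zA [zy zx]] : exists2 z, z \in A & (z < y)%O /\ ~~ (z <= x)%O.
  pose j' := if w k then j else co y.
  have [/andP[/eqP xk e]|ne] := boolP ((lv x == k) && (co x == j')); last first.
    exists (c k j'); first exact: w_in W _ _ kh1.
    rewrite le_eqVlt !(w_lt W) ?(w_in W) // !(w_lv W) // (w_co W) //; split.
      by rewrite /wlt -kS eqxx ltnn /j'; case: (w k); rewrite ?eqxx.
    rewrite negb_or; apply/andP; split.
      apply: contra ne => /eqP <-.
      by rewrite (w_lv W) // (w_co W) // !eqxx.
    apply/negP => /wlt_ltn; lia.
  move: e; rewrite /j'; case: ifP => wx /eqP e.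
    by rewrite e eqxx in jx.
  have k0 : 0 < k.
    by rewrite lt0n; apply: contraFN wx => /eqP ->.
  have [j2 [j2x _]] := third_colour (co x) (co x).
  pose j3 := if w k.-1 then co x else j2.
  have k1h : k.-1 <= h by lia.
  have kE : k.-1.+1 = k by rewrite prednK.
  exists (c k.-1 j3); first exact: w_in W _ _ k1h.
  rewrite le_eqVlt !(w_lt W) ?(w_in W) // !(w_lv W) // (w_co W) //; split.
    by rewrite /wlt kE -kS leqnn.
  rewrite negb_or; apply/andP; split.
    by apply/negP => /eqP /(congr1 lv); rewrite (w_lv W) // xk; lia.
  rewrite /wlt xk kE ltnn eqxx /=; rewrite /j3; case: (w _); rewrite ?eqxx //.
by have := s z; rewrite !inE zA zy (negPf zx) => /(_ isT).
Qed.

Lemma wst_horizon : 1 < h -> horizon A 2.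
Proof.
move=> h1; split=> [k|[|[|//]] _]; rewrite ?wst_height.
- move=> kh x y; rewrite !wst_lev !inE => /andP[xA /eqP xk] /andP[yA /eqP yk].
  by rewrite (w_lt W) // xk yk /wlt addn2 ltnSn.
- move=> /(_ 0 (leq0n _)); rewrite addn0 => H.
  have c0 : c 0 ord0 \in lev A 0 by rewrite wst_levE ?imset_f.
  by have := H _ _ c0 c0; rewrite ltxx.
- move=> /(_ 0 (leq0n _)); rewrite add0n => H.
  have [j [j0 _]] := third_colour ord0 ord0.
  have h0 := ltnW h1.
  have c0 : c 0 ord0 \in lev A 0 by rewrite wst_levE ?imset_f.
  have cj i : c 1 i \in lev A 1 by rewrite (wst_levE h0) imset_f.
  have := H _ _ c0 (cj j); have := H _ _ c0 (cj ord0).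
  by rewrite !wst_c_lt // /wlt ltnn !eqxx (eq_sym ord0 j) (negPf j0); case: (w 0).
Qed.

Lemma wst_N2 : 1 < h -> w 0 -> w h.-1 -> in_N2 A.
Proof.
move=> h1 w0 wh; have h0 := ltnW h1; split.
- by split; [right; apply: wst_section3 | apply: wst_nice].
- by rewrite wst_height.
- exact: wst_horizon.
Qed.

Lemma wst_card_lev k : k <= h -> #|lev A k| = 3.
Proof.
move=> kh; rewrite wst_levE // card_imset ?card_ord //.
by move=> i j /(congr1 co); rewrite !(w_co W).
Qed.

Lemma wst_c_eq k i l j : k <= h -> l <= h ->
  (c k i == c l j) = (k == l) && (i == j).
Proof.
move=> kh lh; apply/eqP/andP => [E|[/eqP -> /eqP ->]//].
have := congr1 co E; have := congr1 lv E; rewrite !(w_lv W) // !(w_co W) //.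
by move=> -> ->.
Qed.

Lemma wst_levU k : k < h -> lev A k :|: lev A k.+1 =
  [set c k ord0; c k colour1; c k colour2; c k.+1 ord0; c k.+1 colour1; c k.+1 colour2].
Proof.
move=> kh; rewrite !wst_levE ?(ltnW kh) //; apply/setP => x; rewrite !inE.
apply/orP/idP.
  by case=> /imsetP[i _ ->]; case: (I3P i) => ->; rewrite eqxx ?orbT.
by rewrite -!orbA => /or4P[||| /or3P[||]] /eqP ->;
   [left|left|left|right|right|right]; rewrite imset_f.
Qed.

Lemma wst_levU_card k : k < h -> #|lev A k :|: lev A k.+1| = 6.
Proof.
move=> kh; have kh1 := ltnW kh; rewrite cardsU !wst_card_lev //.
rewrite (_ : _ :&: _ = set0) ?cards0 //; apply/setP => x.
rewrite in_setI !wst_lev !inE; apply/negP => /andP[/andP[_ /eqP ->] /andP[_]].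
by rewrite eqn_leq ltnn andbF.
Qed.

Lemma wst_levU_ind k (R : T -> T -> Prop) : k < h ->
    (forall i j, [/\ R (c k i) (c k j), R (c k i) (c k.+1 j),
                     R (c k.+1 i) (c k j) & R (c k.+1 i) (c k.+1 j)]) ->
  {in lev A k :|: lev A k.+1 &, forall x y, R x y}.
Proof.
move=> kh H x y; rewrite !in_setU !wst_levE ?(ltnW kh) //.
by move=> /orP[] /imsetP[i _ ->] /orP[] /imsetP[j _ ->]; have [] := H i j.
Qed.

Lemma wst_3C k : k < h -> w k = false -> type_3C (lev A k :|: lev A k.+1).
Proof.
move=> kh wk; have kh1 := ltnW kh.
exists (c k ord0), (c k colour1), (c k colour2), (c k.+1 ord0), (c k.+1 colour1), (c k.+1 colour2).
split; [exact: wst_levU|exact: wst_levU_card|].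
apply: (wst_levU_ind kh) => i j; rewrite !wst_c_lt // !wst_c_eq //.
rewrite /wlt !ltnn !eqxx wk !(eqn_leq k) !(eqn_leq k.+1) leqnSn !ltnn.
case: (I3P i) => ->; case: (I3P j) => ->; rewrite !I3_eq ?eqxx //=.
all: by split=> //; lia.
Qed.

Lemma wst_crown6 : h = 1 -> w 0 -> crown6 A.
Proof.
move=> h1 w0; have h0 : 0 < h by rewrite h1.
have AE : A = lev A 0 :|: lev A 1.
  apply/setP => x; rewrite in_setU !wst_lev !inE -andb_orr.
  case xA: (x \in A) => //=; have := w_le W xA; rewrite h1.
  by case: (lv x) => [|[]].
(* In the cyclic notation of the 6-crown, [x0], [x1], [x2] are incomparable to [y1], [y2], [y0]
   respectively; this explains the order of the upper colours. *)
exists (c 0 ord0), (c 0 colour1), (c 0 colour2), (c 1 colour2), (c 1 ord0), (c 1 colour1).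
rewrite {1 2}AE; split; [|exact: (wst_levU_card h0)|].
  by rewrite wst_levU //; apply/setP => x; rewrite !inE -!orbA; do !bool_congr;
     rewrite orbCA orbC -!orbA; do !bool_congr.
rewrite AE; apply: (wst_levU_ind h0) => i j; rewrite !wst_c_lt // !wst_c_eq //.
rewrite /wlt /= w0.
by case: (I3P i) => ->; case: (I3P j) => ->; rewrite !I3_eq ?eqxx.
Qed.

End Structure.

Lemma word_uniq A h w h' w' : word A h w -> word A h' w' ->
  h = h' /\ forall k, k < h -> w k = w' k.
Proof.
move=> [c [lv [co W]]] [c' [lv' [co' W']]].
have hh : h = h' by rewrite -(wst_height W) (wst_height W').
split=> // k kh; have kh' : k < h' by rewrite -hh.
by apply/idP/idP => [/(wst_word_char W kh)/(wst_word_char W' kh')|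
  /(wst_word_char W' kh')/(wst_word_char W kh)].
Qed.

(** In a 3C no element has two upper neighbours, so [wst_word_char] excludes a crown. *)
Lemma word_3C A h w k : word A h w -> k < h ->
  type_3C (lev A k :|: lev A k.+1) -> w k = false.
Proof.
move=> [c [lv [co W]]] kh [a0 [a1 [a2 [b0 [b1 [b2 [AE card6 lt]]]]]]].
apply/negP => wk.
have [x [y [z [xk yk zk yz [xy xz]]]]] := (wst_word_char W kh).1 wk.
have xU : x \in lev A k :|: lev A k.+1 by rewrite in_setU xk.
have yU : y \in lev A k :|: lev A k.+1 by rewrite in_setU yk orbT.
have zU : z \in lev A k :|: lev A k.+1 by rewrite in_setU zk orbT.
have u6 : uniq [:: a0; a1; a2; b0; b1; b2].
  apply/card_uniqP; rewrite /= -card6 AE; apply: eq_card => u.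
  by rewrite !inE -!orbA.
move: xy xz; rewrite !lt // => xy xz; case/eqP: yz.
move: u6; rewrite /= !inE !negb_or => /and5P[/and5P[a01 a02 _ _ _] /and4P[a12 _ _ _] _ _ _].
case/or3P: xy => /andP[/eqP xa /eqP ->]; move: xz; rewrite xa eqxx.
- by rewrite (negPf a01) (negPf a02) /= !orbF => /eqP ->.
- by rewrite eq_sym (negPf a01) (negPf a12) /= !orbF => /eqP ->.
- by rewrite (eq_sym a2) (negPf a02) (eq_sym a2) (negPf a12) /= => /eqP ->.
Qed.

End Words.

Lemma word_emb d d' (T : finPOrderType d) (T' : finPOrderType d') (f : T -> T')
  (A : {set T}) h w : emb f A -> word A h w -> word (f @: A) h w.
Proof.
move=> e [c [lv [co W]]].
apply: (word_intro (c := fun k i => f (c k i))) => [k i kh|_ /imsetP[x xA ->]||].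
- by rewrite imset_f ?(w_in W).
- by exists (lv x), (co x); rewrite (w_le W) // (w_c W).
- move=> k l i j kh lh /(emb_inj e) E.
  have /eqP := E (w_in W _ kh) (w_in W _ lh).
  by rewrite (wst_c_eq W) // => /andP[/eqP -> /eqP ->].
- by move=> k l i j kh lh; rewrite (emb_lt e) ?(w_in W) // (wst_c_lt W).
Qed.

(** * Normal form of crowns and of sections of width three *)

Section NormalForm.
Context {d : Order.disp_t} {T : finPOrderType d}.
Implicit Types (A B : {set T}).

Lemma crown6_word A : crown6 A -> word A 1 (fun=> true).
Proof.
move=> [x0 [x1 [x2 [y0 [y1 [y2 [AE card6 lt]]]]]]].
have u6 : uniq [:: x0; x1; x2; y0; y1; y2].
  apply/card_uniqP; rewrite /= -card6 AE; apply: eq_card => u.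
  by rewrite !inE -!orbA.
pose c (k : nat) (i : 'I_3) := nth x0 [:: x0; x1; x2; y1; y2; y0] (3 * k + i).
have u6' : uniq [:: x0; x1; x2; y1; y2; y0].
  by rewrite -(@perm_uniq _ [:: x0; x1; x2; y0; y1; y2]) //
    -[X in perm_eq X]/([:: x0; x1; x2] ++ [:: y0; y1; y2])
    -[X in perm_eq _ X]/([:: x0; x1; x2] ++ rot 1 [:: y0; y1; y2])
    perm_cat2l perm_sym perm_rot.
have idx k (i : 'I_3) : k <= 1 -> 3 * k + nat_of_ord i < 6.
  by move=> k1; have := ltn_ord i; lia.
have cA k i : k <= 1 -> c k i \in A.
  move=> k1; have : c k i \in [:: x0; x1; x2; y1; y2; y0] by rewrite mem_nth ?idx.
  by rewrite AE !inE -!orbA => /or4P[||| /or3P[||]] ->; rewrite ?orbT.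
have inj k l i j : k <= 1 -> l <= 1 -> (c k i == c l j) = (3 * k + i == 3 * l + j).
  by move=> k1 l1; rewrite nth_uniq ?idx.
apply: (word_intro (c := c)) => //.
- move=> x; rewrite AE !inE -!orbA.
  case/or4P=> [|||/or3P[]] /eqP ->; [exists 0, ord0|exists 0, colour1|exists 0, colour2|
    exists 1, colour2|exists 1, ord0|exists 1, colour1]; by rewrite /c /= ?inordK.
- move=> k l i j k1 l1 /eqP; rewrite inj // => /eqP E.
  have := ltn_ord i; have := ltn_ord j => j3 i3.
  by have kl : k = l by [lia]; split=> //; apply/val_inj => /=; lia.
- move=> k l i j k1 l1; rewrite lt ?cA //.
  have [e0 e1 e2] : [/\ x0 = c 0 ord0, x1 = c 0 colour1 & x2 = c 0 colour2].
    by rewrite /c /= !inordK.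
  have [f0 f1 f2] : [/\ y0 = c 1 colour2, y1 = c 1 ord0 & y2 = c 1 colour1].
    by rewrite /c /= !inordK.
  rewrite e0 e1 e2 f0 f1 f2 !inj // /wlt.
  case: k l k1 l1 => [|[|//]] [|[|//]] _ _; case: (I3P i) => ->; case: (I3P j) => ->;
    by rewrite /= ?I3_eq ?eqxx /colour1 /colour2 /= ?inordK.
Qed.

(** Weaker than a word structure: comparabilities between levels at distance two or more are left
    open, because a section of the retract may have any horizon. *)
Definition normal A (w : nat -> bool) (c : nat -> 'I_3 -> T) : Prop :=
  [/\ 0 < height A, forall k (i : 'I_3), k <= height A -> c k i \in A &
      {in A, forall x, exists k i, k <= height A /\ x = c k i}] /\
  [/\ forall k l i j, k <= height A -> l <= height A ->
        c k i = c l j -> k = l /\ i = j,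
      forall k l i j, k <= height A -> l <= height A ->
        (c k i < c l j)%O -> k < l,
      forall k i j, k < height A ->
        (c k i < c k.+1 j)%O = (if w k then i != j else i == j) &
      forall k, k <= height A -> lev A k = [set c k i | i : 'I_3]].

(** By rotation symmetry, the relation between consecutive levels is given by a set [D] of
    differences modulo 3. It contains 0 because of the chains and is not everything because type 33
    is forbidden: the single difference 0 gives a 3C, two differences give a crown. Re-indexing the
    colours moves the missing difference of each crown to 0. *)
Lemma section3_normal A : section3 A -> exists w c, normal A w c.
Proof.
case=> h [c [[h1 hE AE] [inj chain anti cyc n33]]].
have [mem mono levc card3 _] := grid_lev AE inj chain anti.
have shift k l i j : k <= h -> l <= h -> i < 3 -> j < 3 ->
    (c k i < c l j)%O = (c k (i.+1 %% 3) < c l (j.+1 %% 3))%O.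
  (* The symmetry is given as an implication only; two more rotations return to the start and yield
     the converse. *)
  move=> kh lh i3 j3; apply/idP/idP; first exact: cyc.
  move=> /cyc; rewrite !ltn_mod => /(_ kh lh isT isT).
  move=> /cyc; rewrite !ltn_mod => /(_ kh lh isT isT).
  by case: i i3 => [|[|[|]]] //; case: j j3 => [|[|[|]]].
pose D k j := (c k 0 < c k.+1 j)%O.
have DE k i j : k < h -> i < 3 -> j < 3 ->
    (c k i < c k.+1 j)%O = D k ((j + 3 - i) %% 3).
  move=> kh i3 j3; have kh1 := ltnW kh; rewrite /D.
  case: i i3 => [|[|[|]]] //; case: j j3 => [|[|[|]]] // _ _;
    by do 3? [reflexivity | rewrite shift //=].
have D0 k : k < h -> D k 0 by move=> kh; apply: chain.
have D12 k : k < h -> D k 1 -> D k 2 -> False.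
  move=> kh d1 d2; have kh1 := ltnW kh; apply: (n33 k kh).
  have all i j : i < 3 -> j < 3 -> (c k i < c k.+1 j)%O.
    move=> i3 j3; rewrite DE //; have := ltn_mod (j + 3 - i) 3.
    by case: (_ %% 3) => [|[|[|]]] // _; rewrite D0.
  have inl x : x \in lev A k -> exists2 i, i < 3 & x = c k i.
    rewrite levc // !inE -orbA => /or3P[] /eqP ->;
      by [exists 0|exists 1|exists 2].
  have inl1 x : x \in lev A k.+1 -> exists2 i, i < 3 & x = c k.+1 i.
    rewrite levc // !inE -orbA => /or3P[] /eqP ->;
      by [exists 0|exists 1|exists 2].
  have disj x : x \in lev A k -> x \in lev A k.+1 -> False.
    move=> /inl[i i3 ->] /inl1[j j3 /inj[] //]; lia.
  exists (lev A k), (lev A k.+1); split=> //; rewrite ?card3 //.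
    apply/setP => x; rewrite in_setI in_set0; apply/negP => /andP[].
    exact: disj.
  move=> x y; rewrite !in_setU => /orP[] xk /orP[] yk.
  - have -> : y \in lev A k.+1 = false by apply/negP; apply: disj.
    have [i i3 ->] := inl _ xk; have [j j3 ->] := inl _ yk.
    by rewrite andbF; apply: negbTE; apply: anti.
  - rewrite xk yk; have [i i3 ->] := inl _ xk; have [j j3 ->] := inl1 _ yk.
    exact: all.
  - have -> : y \in lev A k.+1 = false by apply/negP; apply: disj.
    have [i i3 ->] := inl1 _ xk; have [j j3 ->] := inl _ yk.
    by rewrite andbF; apply/negP => /mono; lia.
  - have -> : x \in lev A k = false by apply/negP => /disj; apply.
    have [i i3 ->] := inl1 _ xk; have [j j3 ->] := inl1 _ yk.
    by apply: negbTE; apply: anti.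
pose w k := D k 1 || D k 2.
(* The difference missing in a crown, and 0 for a 3C; [sh] accumulates these shifts level by
   level. *)
pose p k := if D k 1 then 2 else if D k 2 then 1 else 0.
pose fix sh k := if k is k'.+1 then sh k' + p k' else 0.
exists w, (fun k (i : 'I_3) => c k ((i + sh k) %% 3)).
rewrite /normal -hE; split; split=> //.
- by move=> k i kh; rewrite mem ?ltn_mod.
- move=> x; rewrite {1}AE => /mem_grid[k [j [kh j3 ->]]].
  exists k, (inord ((j + 2 * sh k) %% 3)); split=> //; congr c.
  by rewrite inordK ?ltn_mod //; move: (sh k) => n; lia.
- move=> k l i j kh lh /inj; rewrite !ltn_mod => -[] // <- E; split=> //.
  apply/val_inj => /=; have := ltn_ord i; have := ltn_ord j.
  by move: (sh k) E => n; lia.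
- by move=> k l i j kh lh /mono; rewrite !ltn_mod => ->.
- move=> k i j kh; rewrite DE ?ltn_mod //= /w -val_eqE /=.
  have := D12 k kh; have := D0 k kh; rewrite /p.
  have := ltn_ord i; have := ltn_ord j; move: (nat_of_ord i) (nat_of_ord j) (sh k).
  move=> a b n b3 a3 d0 d12.
  have -> : D k (((b + (n + (if D k 1 then 2 else if D k 2 then 1 else 0))) %% 3
    + 3 - (a + n) %% 3) %% 3) = D k ((b + (if D k 1 then 2 else if D k 2 then 1 else 0)
    + 3 - a) %% 3).
    by congr D; case: (D k 1); case: (D k 2); lia.
  move: d12; case d1: (D k 1); case d2: (D k 2) => d12.
  - by case: (d12 isT isT).
  - by case: a a3 => [|[|[|]]] //; case: b b3 => [|[|[|]]] //; rewrite ?d0 ?d1 ?d2.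
  - by case: a a3 => [|[|[|]]] //; case: b b3 => [|[|[|]]] //; rewrite ?d0 ?d1 ?d2.
  - by case: a a3 => [|[|[|]]] //; case: b b3 => [|[|[|]]] //; rewrite ?d0 ?d1 ?d2.
- move=> k kh; rewrite levc //; apply/setP => x; apply/idP/imsetP => [|[i _ ->]].
    suff H j : j < 3 -> exists2 i : 'I_3, i \in 'I_3 & c k j = c k ((i + sh k) %% 3).
      by rewrite !inE -orbA => /or3P[] /eqP ->; apply: H.
    move=> j3; exists (inord ((j + 2 * sh k) %% 3)) => //.
    by rewrite inordK ?ltn_mod //; congr c; move: (sh k) => n; lia.
  have := ltn_mod (i + sh k) 3; case: (_ %% 3) => [|[|[|]]] // _.
  all: by rewrite !inE eqxx ?orbT.
Qed.

(** If the bottom pair were a 3C, an element of level 1 would have only one element below it, which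
    violates niceness; dually at the top. *)
Lemma nice_normal A w c : normal A w c -> nice A -> w 0 /\ w (height A).-1.
Proof.
move=> [[h0 cA onto] [inj mono adj _]] nA; split.
  apply: contraT => /negPf w0.
  have lt : (c 0 ord0 < c 1 ord0)%O by rewrite adj // w0.
  have [_ []] := nA _ _ (cA _ _ (leq0n _)) (cA _ _ h0) lt.
  apply/subsetP => z; rewrite !inE => /andP[zA]; rewrite zA /=.
  have [[|k] [l [kh ->]]] := onto z zA.
    by rewrite adj // w0 => /eqP ->.
  by move=> /mono; rewrite !ltnS; case/(_ kh h0).
have hS : (height A).-1.+1 = height A by rewrite prednK.
have h1 : (height A).-1 <= height A by rewrite leq_pred.
apply: contraT => /negPf wh.
have adj0 l : (c (height A).-1 ord0 < c (height A) l)%O = (ord0 == l).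
  by have := adj (height A).-1 ord0 l; rewrite hS leqnn wh => ->.
have lt : (c (height A).-1 ord0 < c (height A) ord0)%O by rewrite adj0.
have [[]] := nA _ _ (cA _ _ h1) (cA _ _ (leqnn _)) lt.
apply/subsetP => z; rewrite !inE => /andP[zA]; rewrite zA /=.
have [k [l [kh ->]]] := onto z zA => /[dup] /mono; rewrite hS => /(_ h1 kh) hk.
have -> : k = height A by apply/eqP; rewrite eqn_leq kh.
by rewrite adj0 => /eqP <-.
Qed.

Lemma N2_word A : in_N2 A ->
  exists w, [/\ word A (height A) w, 1 < height A, w 0 & w (height A).-1].
Proof.
move=> [nsA h1 [hor _]].
have [_ [[s3 _]|[h0]]] := nice_section_lev nsA; last by rewrite h0 in h1.
have [_ nA] := nsA.
have [w [c nf]] := section3_normal s3.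
have [w0 wh] := nice_normal nf nA.
have [[h0 cA onto] [inj mono adj levc]] := nf.
have Wd : word A (height A) w.
  apply: (word_intro cA onto inj) => k l i j kh lh; rewrite /wlt.
  have [kl|lk] := ltnP k l; last first.
    have -> : (k.+1 < l) = false by lia.
    have -> : (l == k.+1) = false by lia.
    by apply/negP => /mono; rewrite ltnNge lk => /(_ kh lh).
  rewrite leq_eqVlt in kl; case/orP: kl => [/eqP kl|kl]; last first.
    (* Horizon 2 yields the comparabilities at distance exactly two; larger distances follow by
       passing to a lower neighbour of the upper element. *)
    rewrite kl /=; have [n ln] : exists n, l = k + 2 + n.
      by exists (l - (k + 2)); lia.
    rewrite ln in lh *; elim: n j lh {kl ln} => [|n IH] j lh.
      rewrite addn0 in lh *; apply: (hor k); first lia.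
        by rewrite levc ?imset_f.
      by rewrite levc ?imset_f.
    have nh : k + 2 + n < height A by lia.
    have [j' j'j] : exists j', (c (k + 2 + n) j' < c (k + 2 + n).+1 j)%O.
      have [j' [jj _]] := third_colour j j.
      exists (if w (k + 2 + n) then j' else j).
      by rewrite adj //; case: (w _).
    by rewrite addnS; apply: lt_trans j'j; apply: IH; apply: ltnW.
  by rewrite -kl in lh *; rewrite ltnn eqxx /= adj.
by exists w.
Qed.

End NormalForm.

(** * Retracts with a level pair of type 32 *)

Section Retracts.
Context {d : Order.disp_t} {P : finPOrderType d}.
Variables (h : nat) (w : nat -> bool).
Variables (c : nat -> 'I_3 -> P) (lv : P -> nat) (co : P -> 'I_3).
Hypothesis W : word_structure [set: P] h w c lv co.
Implicit Types (x y z : P) (B : {set P}).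

Lemma ltE x y : (x < y)%O = wlt w (lv x) (co x) (lv y) (co y).
Proof. by rewrite (w_lt W). Qed.

Lemma lv_le x : lv x <= h. Proof. exact: (w_le W). Qed.

Lemma cK x : c (lv x) (co x) = x. Proof. exact: (w_c W). Qed.

Lemma lvco_inj x y : lv x = lv y -> co x = co y -> x = y.
Proof. by move=> e1 e2; rewrite -(cK x) -(cK y) e1 e2. Qed.

Lemma lt_lv x y : (x < y)%O -> lv x < lv y.
Proof. by rewrite ltE => /wlt_ltn. Qed.

Lemma lv_lt x y : (lv x).+1 < lv y -> (x < y)%O.
Proof. by rewrite ltE /wlt => ->. Qed.

Lemma lt_succ x y : lv y = (lv x).+1 ->
  (x < y)%O = (if w (lv x) then co x != co y else co x == co y).
Proof. by move=> e; rewrite ltE /wlt e ltnn eqxx. Qed.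

(** The incomparable pair [x i], [y i] bounds the level of [y i] by one more than that of [x i],
    while every other [x j] is strictly below [y i]. So all [x i] share a level, all [y i] lie on
    the next one, and three distinct elements fill a level. *)
Lemma crown_levels (x y : 'I_3 -> P) :
    (forall i j, (x i < y j)%O = (i != j)) ->
  exists k, [/\ k < h, w k, forall i, lv (x i) = k /\ lv (y i) = k.+1,
    forall z, lv z = k -> exists i, z = x i &
    forall z, lv z = k.+1 -> exists i, z = y i].
Proof.
move=> xy.
have lo i j : i != j -> lv (x i) < lv (y j) by rewrite -xy => /lt_lv.
have hi i : lv (y i) <= (lv (x i)).+1.
  by rewrite leqNgt; apply/negP => /lv_lt; rewrite xy eqxx.
have xk i j : lv (x i) <= lv (x j).
  have [->//|ij] := eqVneq i j; have := lo _ _ ij; have := hi j; lia.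
pose k := lv (x ord0).
have xE i : lv (x i) = k by apply/eqP; rewrite eqn_leq !xk.
have yE i : lv (y i) = k.+1.
  have [j [ji _]] := third_colour i i; have := lo _ _ ji; have := hi i.
  by rewrite !xE; lia.
have xinj : injective (fun i => co (x i)).
  move=> i j /lvco_inj; rewrite !xE => /(_ erefl) E; apply/eqP.
  by have := xy i j; rewrite E xy eqxx; case: eqP.
have yinj : injective (fun i => co (y i)).
  move=> i j /lvco_inj; rewrite !yE => /(_ erefl) E; apply/eqP.
  by have := xy i j; rewrite -E xy eqxx; case: eqP.
exists k; split=> //.
- by have := lv_le (y ord0); rewrite yE.
- have [i [i0 _]] := third_colour ord0 ord0; have [j [j0 ji]] := third_colour ord0 i.
  have := xy ord0 i; have := xy ord0 j; rewrite !(eq_sym ord0) i0 j0.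
  rewrite !lt_succ ?xE ?yE //; case: (w k) => // /eqP e1 /eqP e2.
  by case/eqP: ji; apply: yinj; rewrite -e1 e2.
- move=> z zk; have [g _ gK] := injF_bij xinj.
  by exists (g (co z)); apply: lvco_inj; rewrite ?xE // gK.
- move=> z zk; have [g _ gK] := injF_bij yinj.
  by exists (g (co z)); apply: lvco_inj; rewrite ?yE // gK.
Qed.

(** Niceness makes the two top levels of [B] a crown, which by [crown_levels] consists of two full
    consecutive levels of P. *)
Lemma top_crown B : section3 B -> nice B ->
  exists m, [/\ m < h, w m, forall z, lv z = m -> z \in B,
    forall z, lv z = m.+1 -> z \in B &
    forall x z, lv x = m.+1 -> z \in B -> ~~ (x < z)%O].
Proof.
move=> s3 nB; have [wB [cB nf]] := section3_normal s3.
have [_ wh] := nice_normal nf nB; have [[h0 cA onto] [inj mono adj _]] := nf.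
have hS : (height B).-1.+1 = height B by rewrite prednK.
have [|m [mh wm lvs xs ys]] := @crown_levels (cB (height B).-1) (cB (height B)).
  by move=> i j; have := adj (height B).-1 i j; rewrite hS wh leqnn => ->.
exists m; split=> // [z /xs[i ->]|z /ys[i ->]|x z /ys[i ->] zB].
- by rewrite cA // leq_pred.
- by rewrite cA.
- have [k [j [kh ->]]] := onto z zB; apply/negP => /mono.
  by move=> /(_ (leqnn _) kh); rewrite ltnNge kh.
Qed.

Lemma bottom_crown B : section3 B -> nice B ->
  exists q, [/\ q < h, w q, forall z, lv z = q -> z \in B,
    forall z, lv z = q.+1 -> z \in B &
    forall x z, lv x = q -> z \in B -> ~~ (z < x)%O].
Proof.
move=> s3 nB; have [wB [cB nf]] := section3_normal s3.
have [w0 _] := nice_normal nf nB; have [[h0 cA onto] [inj mono adj _]] := nf.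
have [|m [mh wm lvs xs ys]] := @crown_levels (cB 0) (cB 1).
  by move=> i j; have := adj 0 i j h0; rewrite w0.
exists m; split=> // [z /xs[i ->]|z /ys[i ->]|x z /xs[i ->] zB].
- by rewrite cA.
- by rewrite cA.
- have [k [j [kh ->]]] := onto z zB; apply/negP => /mono.
  by move=> /(_ kh (leq0n _)); rewrite ltn0.
Qed.

Lemma c_lv k i : k <= h -> lv (c k i) = k. Proof. exact: (w_lv W). Qed.
Lemma c_co k i : k <= h -> co (c k i) = i. Proof. exact: (w_co W). Qed.

Lemma down_at k y : k < lv y -> exists2 z, lv z = k & (z < y)%O.
Proof.
move=> ky; have yh := lv_le y.
have [ky2|ky2] := ltnP k.+1 (lv y).
  exists (c k ord0); first by rewrite c_lv; lia.
  by rewrite lv_lt // c_lv; lia.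
have yk : lv y = k.+1 by lia.
have [|i lt] := wst_down W (k := k) (co y); first by lia.
by exists (c k i); [rewrite c_lv; lia|rewrite -[y]cK yk].
Qed.

Lemma up_at k y : lv y < k -> k <= h -> exists2 z, lv z = k & (y < z)%O.
Proof.
move=> yk kh; have [ky2|ky2] := ltnP (lv y).+1 k.
  by exists (c k ord0); rewrite ?lv_lt // c_lv.
have {}yk : k = (lv y).+1 by lia.
rewrite yk in kh *; have [j lt] := wst_up W (co y) kh.
by exists (c (lv y).+1 j); [rewrite c_lv | rewrite -[X in (X < _)%O]cK].
Qed.

Lemma all_below k y : k < h -> w k -> (forall z, lv z = k -> (z <= y)%O) ->
  k.+1 < lv y.
Proof.
move=> kh wk H; have kh1 := ltnW kh; rewrite ltnNge; apply/negP => yk.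
have [i [iy _]] := third_colour (co y) (co y).
(* The colour of an element of level [k] that [y] fails to dominate: its own colour from the next
   level, another colour from level [k] itself. *)
pose j := if lv y == k.+1 then co y else i.
have := H (c k j) (c_lv _ kh1); rewrite le_eqVlt => /orP[/eqP E|].
  have yk1 : lv y = k by rewrite -E c_lv.
  have : co y = j by rewrite -E c_co.
  by rewrite /j yk1 ltn_eqF // => yi; rewrite -yi eqxx in iy.
move=> /[dup] /lt_lv; rewrite c_lv // => ky; have ykE : lv y = k.+1 by lia.
by rewrite lt_succ c_lv // wk c_co // /j ykE eqxx eqxx.
Qed.

Lemma all_above k y : k < h -> w k -> (forall z, lv z = k.+1 -> (y <= z)%O) ->
  lv y < k.
Proof.
move=> kh wk H; have kh1 := ltnW kh; rewrite ltnNge; apply/negP => yk.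
have [i [iy _]] := third_colour (co y) (co y).
pose j := if lv y == k then co y else i.
have := H (c k.+1 j) (c_lv _ kh); rewrite le_eqVlt => /orP[/eqP E|].
  have yk1 : lv y = k.+1 by rewrite E c_lv.
  have : co y = j by rewrite E c_co.
  by rewrite /j yk1 gtn_eqF // => yi; rewrite -yi eqxx in iy.
move=> /[dup] /lt_lv; rewrite c_lv // => ky; have ykE : lv y = k by lia.
by rewrite lt_succ ?c_lv ?ykE // wk c_co // /j ykE eqxx eqxx.
Qed.

(** With either letter, an element misses some element of the level directly below it. *)
Lemma strictly_all_below k y : k < h -> (forall z, lv z = k -> (z < y)%O) ->
  k.+1 < lv y.
Proof.
move=> kh H; have kh1 := ltnW kh; rewrite ltnNge; apply/negP => yk.
have ky : lv y = k.+1.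
  by have := lt_lv (H (c k ord0) (c_lv _ kh1)); rewrite c_lv //; lia.
have [i [iy _]] := third_colour (co y) (co y).
have := H (c k (if w k then co y else i)) (c_lv _ kh1).
rewrite lt_succ c_lv // c_co //.
by case: (w k); rewrite ?eqxx // (negPf iy).
Qed.

Hypothesis w_top : w h.-1.
Hypothesis h_gt0 : 0 < h.

Variable r : P -> P.
Hypothesis r_idem : forall x, r (r x) = r x.
Hypothesis r_mono : forall x y, (x <= y)%O -> (r x <= r y)%O.

Lemma r_fix x : x \in r @: [set: P] -> r x = x.
Proof. by case/imsetP => y _ ->. Qed.

Lemma r_in x : r x \in r @: [set: P]. Proof. exact: imset_f. Qed.

(* Everything above the top section [B] of width three is mapped above [B]:
   it dominates the whole lower level of the top crown of [B]. *)
Lemma above_section3 s1 B s2 : r @: [set: P] = usum (s1 ++ B :: s2) ->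
    tower (s1 ++ B :: s2) -> section3 B ->
  exists m, [/\ m < h, w m, forall z, lv z = m.+1 -> z \in B &
    forall x, m.+1 < lv x -> r x \in usum s2].
Proof.
move=> RE /tower_cat[_ [[_ nB] lt t2] lt1] s3.
have [m [mh wm lo hi mx]] := top_crown s3 nB; exists m; split=> // x xm.
have fixB z : z \in B -> r z = z.
  by move=> zB; apply: r_fix; rewrite RE usum_cat usum_cons !inE zB orbT.
have ge z : lv z = m -> (z <= r x)%O.
  by move=> zm; rewrite -(fixB z (lo z zm)) r_mono // ltW // lv_lt // zm.
have := r_in x; rewrite RE usum_cat usum_cons !inE => /or3P[r1|rB|//].
  have z0 : lv (c m ord0) = m by rewrite c_lv // ltnW.
  have := lt1 _ (c m ord0) r1; rewrite usum_cons inE lo // => /(_ isT) /lt_geF.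
  by rewrite ge.
have [z zm zr] := down_at (all_below mh wm ge).
by case/negP: (mx z (r x) zm rB).
Qed.

(** * A two-element section above a threshold level *)

Section Step.
Variables (s1 s2 : seq {set P}) (Y : {set P}) (t : nat).
Hypothesis RE : r @: [set: P] = usum (s1 ++ Y :: s2).
Hypothesis tow : tower (s1 ++ Y :: s2).
Hypothesis cardY : #|Y| = 2.
Hypothesis t_up : forall x, t <= lv x -> r x \in usum (Y :: s2).
Hypothesis Y_up : forall y, y \in Y -> t < lv y.

Let nice_Y : nice_section Y.
Proof. by have /tower_cat[_ []] := tow. Qed.

Let Y_lt : setlt Y (usum s2).
Proof. by have /tower_cat[_ []] := tow. Qed.

Lemma fix_up z : z \in usum (Y :: s2) -> r z = z.
Proof. by move=> zU; apply: r_fix; rewrite RE usum_cat inE zU orbT. Qed.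

(** The image of [x] is at most [r y = y] and lies in [Y] or above it; since [Y] is an antichain,
    only [y] remains. *)
Lemma up_le x y : t <= lv x -> y \in Y -> (x <= y)%O -> r x = y.
Proof.
move=> tx yY xy; have ry : r y = y by rewrite fix_up // usum_cons inE yY.
have rxy : (r x <= y)%O by rewrite -ry r_mono.
have := t_up tx; rewrite usum_cons inE => /orP[rY|rs].
  have [a [b [YE ab nab nba]]] := section2 nice_Y cardY.
  move: rY yY rxy; rewrite YE !inE => /orP[] /eqP -> /orP[] /eqP -> //;
    by rewrite le_eqVlt ?(negPf nab) ?(negPf nba) orbF => /eqP.
by have := lt_geF (Y_lt yY rs); rewrite rxy.
Qed.

(** If [y] were higher, it would dominate all of level [t], including an element below the other
    member of [Y]; by [up_le] that element would have two images. *)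
Lemma Y_level y : y \in Y -> lv y = t.+1.
Proof.
move=> yY; apply/eqP; rewrite eqn_leq Y_up // andbT leqNgt; apply/negP => ty.
have [a [b [YE ab nab nba]]] := section2 nice_Y cardY.
have [y' y'Y y'y] : exists2 y', y' \in Y & y' != y.
  move: yY; rewrite YE !inE => /orP[] /eqP ->.
    by exists b; rewrite ?inE ?eqxx ?orbT // eq_sym.
  by exists a; rewrite ?inE ?eqxx.
have [z zt zy'] := down_at (Y_up y'Y).
have E' := up_le (eq_leq (esym zt)) y'Y (ltW zy').
have zy : (z < y)%O by rewrite lv_lt // zt.
by case/eqP: y'y; rewrite -E' (up_le (eq_leq (esym zt)) yY (ltW zy)).
Qed.

Lemma Y_common z y y' : y \in Y -> y' \in Y -> lv z = t -> (z < y)%O ->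
  (z < y')%O -> y = y'.
Proof.
move=> yY y'Y zt zy zy'; have tz := eq_leq (esym zt).
by rewrite -(up_le tz yY (ltW zy)) (up_le tz y'Y (ltW zy')).
Qed.

(** In a crown, the element of level [t] with the third colour would lie below both elements of
    [Y]. *)
Lemma Y_word : w t = false.
Proof.
apply/negP => wt; have [a [b [YE ab nab nba]]] := section2 nice_Y cardY.
have aY : a \in Y by rewrite YE !inE eqxx.
have bY : b \in Y by rewrite YE !inE eqxx orbT.
have [i [ia ib]] := third_colour (co a) (co b).
have th : t <= h by have := lv_le a; rewrite Y_level // => /ltnW.
case/eqP: ab; apply: (Y_common (z := c t i)) => //; first by rewrite c_lv.
all: by rewrite lt_succ ?c_lv ?Y_level // wt c_co.
Qed.

Lemma Y_height : t.+1 < h.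
Proof.
have [a [b [YE _ _ _]]] := section2 nice_Y cardY.
have := lv_le a; rewrite Y_level ?YE ?inE ?eqxx // leq_eqVlt => /orP[/eqP th|//].
by have := w_top; rewrite -th Y_word.
Qed.

(** Each element of [Y] is the image of an element of level [t], and [x] dominates that whole level.
    So the image of [x] is above both elements of [Y] and cannot belong to [Y]. *)
Lemma Y_above x : t.+1 < lv x -> r x \in usum s2.
Proof.
move=> tx; have [a [b [YE ab nab nba]]] := section2 nice_Y cardY.
have ge y : y \in Y -> (y <= r x)%O.
  move=> yY; have [z zt zy] := down_at (Y_up yY).
  rewrite -(up_le (eq_leq (esym zt)) yY (ltW zy)) r_mono // ltW // lv_lt // zt.
  by [].
have := t_up (ltnW (ltnW tx)); rewrite usum_cons inE => /orP[|//].
have := ge a; have := ge b; rewrite YE !inE !eqxx orbT => /(_ isT) bx /(_ isT) ax.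
case/orP=> /eqP E; rewrite E !le_eqVlt ?(negPf nab) ?(negPf nba) !orbF in ax bx.
  by rewrite eq_sym (negPf ab) in bx.
by rewrite (negPf ab) in ax.
Qed.

(** Some section follows because the top level is mapped above [Y]. Were it of width three, its
    bottom crown would fill levels [q] and [q.+1]. An element of level [q.-1] is mapped into this
    section or above it, yet its image is below all of level [q.+1], hence below level [q], where
    that part of the image has no elements. *)
Lemma Y_next : exists Y' s3, s2 = Y' :: s3 /\ #|Y'| = 2.
Proof.
have [a [b [YE _ _ _]]] := section2 nice_Y cardY.
have aY : a \in Y by rewrite YE !inE eqxx.
have th := Y_height.
case: s2 RE tow t_up Y_lt Y_above => [|Y' s3] RE' tow' t_up' lt above.
  have := above (c h ord0); rewrite c_lv // => /(_ th).
  by rewrite /usum big_nil inE.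
exists Y', s3; split=> //.
have /tower_cat[_ [_ _ [nY' lt' _]] _] := tow'.
have [_ [[s3Y' _]|[_ _ -> //]]] := nice_section_lev nY'.
have [q [qh wq lo hi mn]] := bottom_crown s3Y' nY'.2.
have qh1 := ltnW qh.
have gt z : lv z = q -> (a < z)%O.
  by move=> zq; apply: lt => //; rewrite usum_cons inE lo.
(* No element lies below the whole next level, so level [q] is at least two above [Y]; this puts
   level [q.-1] in the range of [Y_above]. *)
have tq : t.+2 < q.
  rewrite ltnNge; apply/negP => qt.
  have := lt_lv (gt _ (c_lv ord0 qh1)); rewrite c_lv // (Y_level aY) => tq.
  have qE : q = t.+2 by lia.
  have [i [ia _]] := third_colour (co a) (co a).
  have := gt (c q (if w t.+1 then co a else i)) (c_lv _ qh1).
  rewrite lt_succ ?c_lv ?(Y_level aY) // c_co //.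
  by case: (w t.+1); rewrite ?eqxx // eq_sym (negPf ia).
have q0 : q.-1 <= h by lia.
pose x := c q.-1 ord0; have xq : lv x = q.-1 by rewrite c_lv.
have rx : r x \in usum (Y' :: s3) by apply: above; rewrite xq; lia.
have fixY' z : z \in Y' -> r z = z.
  move=> zY; apply: r_fix; rewrite RE' usum_cat !usum_cons !inE zY.
  by rewrite !orbT.
have le z : lv z = q.+1 -> (r x <= z)%O.
  move=> zq; rewrite -(fixY' z (hi z zq)) r_mono // ltW // lv_lt // xq zq.
  by lia.
have rq := all_above qh wq le.
have [z zq rz] := up_at rq qh1.
move: rx; rewrite usum_cons inE => /orP[rY'|rs].
  by case/negP: (mn _ _ zq rY').
have := lt' z (r x) (lo z zq) rs; rewrite lt_gtF //.
Qed.


Section Crown.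
Hypothesis w_t1 : w t.+1.
Variables (Y' : {set P}) (s3 : seq {set P}).
Hypotheses (s2E : s2 = Y' :: s3) (cardY' : #|Y'| = 2).

(** Above a crown only the element of the third colour on level [t.+2] dominates both elements of
    [Y], so at most one element of [Y'] lies there. *)
Lemma Y'_up : exists a' b', [/\ Y' = [set a'; b'], a' != b', ~~ (a' < b')%O,
  ~~ (b' < a')%O & t.+2 < lv a' \/ t.+2 < lv b'].
Proof.
have [a [b [YE ab nab nba]]] := section2 nice_Y cardY.
have nice_Y' : nice_section Y' by have := tow; rewrite s2E => /tower_cat[_ [_ _ []]].
have [a' [b' [YE' ab' nab' nba']]] := section2 nice_Y' cardY'.
exists a', b'; split=> //.
have [aY bY] : a \in Y /\ b \in Y by rewrite YE !inE !eqxx orbT.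
have gt y y' : y \in Y -> y' \in Y' -> (y < y')%O.
  by move=> yY y'Y; apply: Y_lt; rewrite // s2E usum_cons inE y'Y.
have [aY' bY'] : a' \in Y' /\ b' \in Y' by rewrite YE' !inE !eqxx orbT.
have co_neq y y' : y \in Y -> y' \in Y' -> lv y' = t.+2 -> co y != co y'.
  by move=> yY y'Y lv'; have := gt _ _ yY y'Y; rewrite lt_succ (Y_level yY) // w_t1.
have ge y' : y' \in Y' -> t.+2 <= lv y'.
  by move=> y'Y; have := lt_lv (gt _ _ aY y'Y); rewrite Y_level.
have := ge _ bY'; rewrite leq_eqVlt => /orP[/eqP eb|]; last by right.
have := ge _ aY'; rewrite leq_eqVlt => /orP[/eqP ea|]; last by left.
case/eqP: ab'; apply: lvco_inj; first by rewrite -ea.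
apply: (colour_unique (i := co a) (j := co b)); last first.
- by rewrite eq_sym co_neq.
- by rewrite eq_sym co_neq.
- by rewrite eq_sym co_neq.
- by rewrite eq_sym co_neq.
- by apply: contra ab => /eqP e; apply/eqP; apply: lvco_inj; rewrite ?Y_level.
Qed.

(** If [Y'] were the last section, two top elements of P would have a common lower neighbour mapped
    into the antichain [Y'], so the top level would have a single image. Every element of [Y'] is
    below a top element and would equal that image. The further section then lies above an element
    of [Y'] that is higher than level [t.+2]. *)
Lemma W_height : s3 != [::] /\ t.+3 < h.
Proof.
have [a' [b' [YE' ab' nab' nba' up']]] := Y'_up.
have th : t.+2 < h.
  by case: up' => /leq_trans; apply; apply: lv_le.
have s30 : s3 != [::].
  apply/eqP => s30; have rY' x : t.+1 < lv x -> r x \in Y'.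
    by move=> /Y_above; rewrite s2E s30 usum_cons /usum big_nil setU0.
  have anti x y : x \in Y' -> y \in Y' -> (x <= y)%O -> x = y.
    rewrite YE' !inE => /orP[] /eqP -> /orP[] /eqP -> //;
      by rewrite le_eqVlt ?(negPf nab') ?(negPf nba') orbF => /eqP.
  have hS : h.-1.+1 = h by rewrite prednK.
  have const i j : r (c h i) = r (c h j).
    have [k [ki kj]] := third_colour i j.
    have lvk : lv (c h.-1 k) = h.-1 by rewrite c_lv // leq_pred.
    have rk : r (c h.-1 k) \in Y' by apply: rY'; rewrite lvk; lia.
    have le l : k != l -> r (c h.-1 k) = r (c h l).
      have rl : r (c h l) \in Y' by apply: rY'; rewrite c_lv // ltnW.
      move=> kl; apply: (anti _ _ rk rl); apply/r_mono/ltW; rewrite lt_succ lvk ?c_lv ?hS //.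
      by rewrite w_top c_co ?leq_pred // c_co.
    by rewrite -le // -le.
  have top u : u \in Y' -> u = r (c h ord0).
    move=> uY; have ru : r u = u by apply: fix_up; rewrite s2E !usum_cons !inE uY orbT.
    have r0 : r (c h ord0) \in Y' by apply: rY'; rewrite c_lv // ltnW.
    apply: (anti _ _ uY r0).
    have [i le] : exists i, (u <= c h i)%O.
      have := lv_le u; rewrite leq_eqVlt => /orP[/eqP uh|uh].
        by exists (co u); rewrite -uh cK.
      have [z zh /ltW uz] := up_at uh (leqnn h).
      by exists (co z); rewrite -zh cK.
    by rewrite (const _ i) -[X in (X <= _)%O]ru r_mono.
  have [aY' bY'] : a' \in Y' /\ b' \in Y' by rewrite YE' !inE !eqxx orbT.
  by move: ab'; rewrite {1}(top a' aY') {1}(top b' bY') eqxx.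
split=> //; case: s3 s30 s2E => // Z s4 _ s2E'.
have := tow; rewrite s2E' => /tower_cat[_ [_ _ [_ lt [nZ _ _]]] _].
have /set0Pn[e eZ] : Z != set0.
  by apply: contraNneq (nice_section_lev_top nZ) => ->; rewrite lev_set0.
have gt y : y \in Y' -> lv y < lv e.
  by move=> yY; apply/lt_lv/lt; rewrite // usum_cons inE eZ.
have := lv_le e; have := gt a'; have := gt b'.
rewrite YE' !inE !eqxx orbT => /(_ isT) + /(_ isT).
by case: up'; lia.
Qed.

End Crown.
End Step.

(** Invariant of the climb: the map is controlled from level [t] on only. *)
Definition step_at s1 Y s2 t :=
  [/\ r @: [set: P] = usum (s1 ++ Y :: s2), tower (s1 ++ Y :: s2), #|Y| = 2,
      forall x, t <= lv x -> r x \in usum (Y :: s2) &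
      forall y, y \in Y -> t < lv y].

(* The two-element sections [Y] climb two levels at a time through the
   3C-part of the word until the first crown. *)
Lemma climb s1 Y s2 t : step_at s1 Y s2 t ->
  exists s1' Y1 Y2 s3 t', [/\ step_at s1' Y1 (Y2 :: s3) t', #|Y2| = 2,
    t <= t' /\ ~~ odd (t' - t),
    forall i, t <= i <= t' -> w i = false & w t'.+1].
Proof.
move: {2}(h - t) (leqnn (h - t)) => n.
elim: n s1 Y s2 t => [|n IH] s1 Y s2 t hn S; have [RE tow cY tup Yup] := S.
  by have := Y_height RE tow cY tup Yup; lia.
have th := Y_height RE tow cY tup Yup.
have wt := Y_word RE tow cY tup Yup.
have [Y' [s3 [s2E cY']]] := Y_next RE tow cY tup Yup.
have above := Y_above RE tow cY tup Yup.
have lvY := Y_level RE tow cY tup Yup.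
case wt1: (w t.+1).
  exists s1, Y, Y', s3, t; rewrite -s2E subnn leqnn; split=> // i it.
  by have -> : i = t by lia.
have S' : step_at (s1 ++ [:: Y]) Y' s3 t.+2.
  rewrite s2E in RE tow; split=> //; rewrite -?catA //.
    by move=> x tx; rewrite -s2E; apply: above.
  move=> y' y'Y; have [_ [nY lt _] _] := (tower_cat _ _).1 tow.
  have [a [b [YE ab _ _]]] := section2 nY cY.
  have gt y : y \in Y -> (y < y')%O.
    by move=> yY; apply: lt; rewrite // usum_cons inE y'Y.
  have [aY bY] : a \in Y /\ b \in Y by rewrite YE !inE !eqxx orbT.
  (* On level [t.+2] of a 3C, [y'] would have a single lower neighbour, but it is above both
     elements of [Y]. So the new threshold is [t.+2]. *)
  have := lt_lv (gt a aY); rewrite (lvY a aY) leq_eqVlt => /orP[/eqP y't|//].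
  have cE y : y \in Y -> co y = co y'.
    by move=> yY; have := gt y yY; rewrite lt_succ (lvY y yY) // wt1 => /eqP.
  by case/eqP: ab; apply: lvco_inj; rewrite ?lvY // !cE.
have [|s1' [Y1 [Y2 [s4 [t' [S1 cY2 [tt' odd'] w' wt']]]]]] := IH _ _ _ _ _ S'.
  by lia.
exists s1', Y1, Y2, s4, t'; split=> //.
  split; first by lia.
  have -> : t' - t = (t' - t.+2).+2 by lia.
  by rewrite /= negbK.
move=> i /andP[ti it']; have [->|it] := eqVneq i t => //.
have [->|it1] := eqVneq i t.+1 => //; apply: w'; lia.
Qed.

End Retracts.

(** * From a retract to a stack *)

Section Subposets.
Context {d : Order.disp_t} {P : finPOrderType d}.

Definition subposet (A : {set P}) := {x : P | x \in A}.

HB.instance Definition _ (A : {set P}) := SubFinite.on (subposet A).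
HB.instance Definition _ (A : {set P}) :=
  [SubChoice_isSubPOrder of subposet A by <: with d].

Lemma subposet_emb (A : {set P}) x0 : x0 \in A ->
  exists f : P -> subposet A, [/\ emb f A, f @: A = [set: subposet A],
    {in A, forall x, val (f x) = x} & forall y, f (val y) = y].
Proof.
move=> x0A; pose f x : subposet A := insubd (Sub x0 x0A) x.
have fE : {in A, forall x, val (f x) = x} by move=> x xA; rewrite /f insubdK.
have fK y : f (val y) = y by rewrite /f valKd.
exists f; split=> //.
- by move=> x y xA yA; rewrite leEsub !fE.
- apply/setP => y; rewrite inE; apply/imsetP; exists (val y); rewrite ?fK //.
  exact: valP.
Qed.

End Subposets.

Lemma seg_emb d d' (T : finPOrderType d) (T' : finPOrderType d') (f : T -> T')
  (A : {set T}) k l : emb f A -> seg (f @: A) k l = f @: seg A k l.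
Proof.
move=> e; rewrite /seg; elim/big_rec2: _ => [|i B C _ ->]; first by rewrite imset0.
by rewrite imsetU lev_emb.
Qed.

Lemma emb_poset_iso d d' (T : finPOrderType d) (T' : finPOrderType d')
  (f : T -> T') (A : {set T}) B : emb f A -> f @: A = B -> poset_iso A B.
Proof. by move=> e fA; exists f; split=> //; apply: emb_inj. Qed.

Section WordFacts.
Context {d : Order.disp_t} {T : finPOrderType d}.
Implicit Types (A : {set T}).

Lemma word_interval A h w k l : word A h w -> k <= l -> l <= h ->
  word (seg A k l) (l - k) (fun i => w (k + i)).
Proof.
move=> [c [lv [co W]]] kl lh; rewrite (wst_seg W).
exists (fun i => c (k + i)), (fun x => lv x - k), co.
exact: (wst_interval W kl lh).
Qed.

Lemma word_seg_lev A h w k l i : word A h w -> k <= l -> l <= h -> i <= l - k ->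
  lev (seg A k l) i = lev A (k + i).
Proof.
move=> [c [lv [co W]]] kl lh il; rewrite (wst_seg W).
have W' := wst_interval W kl lh.
rewrite (wst_levE W' il) (wst_levE W) //; lia.
Qed.

Lemma word_height A h w : word A h w -> height A = h.
Proof. by move=> [c [lv [co W]]]; apply: wst_height W. Qed.

(** Dropping level 0 removes the letter [w 0], which is therefore unrestricted. *)
Lemma word_stack3C A h w : word A h w -> 0 < h ->
  stack3C (seg A 1 h) <-> forall i, 0 < i < h -> w i = false.
Proof.
move=> Wd h0; have Wd1 := word_interval Wd h0 (leqnn h).
rewrite /stack3C (word_height Wd1); split=> [st i /andP[i0 ih]|wf i ih].
  have /st : i.-1 < h - 1 by lia.
  rewrite !(word_seg_lev Wd) //; try lia.
  rewrite !add1n prednK //; exact: word_3C Wd ih.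
have [c [lv [co W]]] := Wd1; apply: (wst_3C W ih).
by rewrite wf //; lia.
Qed.

End WordFacts.


(** * Intervals of levels as posets of their own *)

Section Intervals.
Context {d : Order.disp_t} {P : finPOrderType d}.
Variables (h : nat) (w : nat -> bool).
Variables (c : nat -> 'I_3 -> P) (lv : P -> nat) (co : P -> 'I_3).
Hypothesis W : word_structure [set: P] h w c lv co.

Let Wd : word [set: P] h w. Proof. by exists c, lv, co. Qed.

Lemma mem_seg k l x : (x \in seg [set: P] k l) = (k <= lv x <= l).
Proof. by rewrite (wst_seg W) inE in_setT. Qed.

Lemma interval_subposet k l (A := seg [set: P] k l) : k <= l -> l <= h ->
  [/\ exists f : P -> subposet A, [/\ emb f A, f @: A = [set: subposet A],
        {in A, forall x, val (f x) = x} & forall y, f (val y) = y],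
      word [set: subposet A] (l - k) (fun i => w (k + i)) &
      poset_iso A [set: subposet A]].
Proof.
move=> kl lh; have [|f [e fA fK Kf]] := @subposet_emb _ _ A (c k ord0).
  by rewrite mem_seg (w_lv W) ?leqnn //; apply: leq_trans lh.
split; first by exists f.
  by rewrite -fA; apply: word_emb e _; apply: word_interval Wd _ _.
exact: emb_poset_iso e fA.
Qed.

Lemma interval_N2 k l : k.+1 < l -> l <= h -> w k -> w l.-1 ->
  in_N2 [set: subposet (seg [set: P] k l)].
Proof.
move=> kl lh wk wl; have [_ [c' [lv' [co' W']]] _] := interval_subposet (ltnW (ltnW kl)) lh.
apply: (wst_N2 W'); rewrite ?addn0 //; first by lia.
by have -> : k + (l - k).-1 = l.-1 by lia.
Qed.

(** One level is added on each side: the bordering letters are crowns, so the larger interval is in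
    N2 and this one is its middle part. *)
Lemma interval_N2Seg k l : 0 < k -> k <= l -> l < h -> w k.-1 -> w l ->
  in_N2Seg [set: subposet (seg [set: P] k l)].
Proof.
move=> k0 kl lh wk wl; set A := seg _ k l.
have [[fA [eA iA KA AK]] _ _] := interval_subposet kl (ltnW lh).
have kl' : k.-1 <= l.+1 by lia.
have [[f [e iB fK Kf]] WB _] := interval_subposet kl' lh.
set B := seg [set: P] k.-1 l.+1 in f e iB fK Kf WB.
exists d, (subposet B); split; first by apply: interval_N2; rewrite //; lia.
have sAB : A \subset B by apply/subsetP => x; rewrite !mem_seg; lia.
have vB (v : subposet A) : val v \in B by apply: (subsetP sAB); apply: valP.
rewrite (word_height WB) -iB (seg_emb _ _ e).
have -> : seg B 1 (l.+1 - k.-1).-1 = A.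
  apply/setP => x; rewrite mem_seg /B (wst_seg W).
  rewrite (wst_seg (wst_interval W kl' lh)) !inE /=.
  by move: (lv x) k0 kl {A fA eA iA KA AK kl' f e iB fK Kf WB B sAB vB wk wl lh}; lia.
exists (fun v => f (val v)); split.
- by move=> x y _ _ /(emb_inj e (vB x) (vB y)) E; apply: val_inj.
- apply/setP => y; apply/imsetP/imsetP => -[x xA ->].
    by exists (val x) => //; apply: valP.
  by exists (fA x); rewrite ?inE // KA.
- by move=> x y _ _; rewrite e.
Qed.

Lemma interval_V k l : k.+1 < l -> l <= h -> ~~ odd (l - k) ->
    (forall i, k < i < l -> w i = false) ->
  let V := [set: subposet (seg [set: P] k l)] in
  [/\ section3 V, 2 <= height V, ~~ odd (height V) & stack3C (seg V 1 (height V))].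
Proof.
move=> kl lh ev wF V.
have [_ WV _] := interval_subposet (ltnW (ltnW kl)) lh.
have [c' [lv' [co' W']]] := WV; rewrite (word_height WV); split=> //.
- by apply: (wst_section3 W'); lia.
- by lia.
- by apply/(word_stack3C WV) => [|i ih]; [lia | apply: wF; lia].
Qed.

(** * The given retraction on the levels from [Y1] upwards *)

Section UpperPart.
Hypothesis w_top : w h.-1.
Variable r : P -> P.
Hypothesis r_idem : forall x, r (r x) = r x.
Hypothesis r_mono : forall x y, (x <= y)%O -> (r x <= r y)%O.
Variables (s1 s3 : seq {set P}) (Y1 Y2 : {set P}) (t : nat).
Hypothesis st : step_at lv r s1 Y1 (Y2 :: s3) t.
Hypothesis cY2 : #|Y2| = 2.
Hypothesis wt1 : w t.+1.

Let A := seg [set: P] t.+1 h.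
Let S := usum (Y1 :: Y2 :: s3).

Let h0 : 0 < h.
Proof.
have [RE tow cY1 tup Yup] := st.
have /card_gt0P[y yY] : 0 < #|Y1| by rewrite cY1.
by have := lv_le W y; have := Yup y yY; lia.
Qed.

Lemma upper_height : s3 != [::] /\ t.+3 < h.
Proof.
have [RE tow cY1 tup Yup] := st.
exact: (W_height W w_top h0 r_idem r_mono RE tow cY1 tup Yup wt1 erefl cY2).
Qed.

Let Y1_lev y : y \in Y1 -> lv y = t.+1.
Proof.
have [RE tow cY1 tup Yup] := st.
exact: (Y_level W r_idem r_mono RE tow cY1 tup Yup).
Qed.

Let S_up x : x \in S -> x \in A.
Proof.
have [RE tow cY1 tup Yup] := st.
rewrite mem_seg (lv_le W) andbT /S usum_cons inE => /orP[/Y1_lev -> //|xs].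
have [_ [nY1 lt _] _] := (tower_cat _ _).1 tow.
have /card_gt0P[y yY] : 0 < #|Y1| by rewrite cY1.
by have := lt_lv W (lt _ _ yY xs); rewrite Y1_lev // => /ltnW.
Qed.

Let r_S x : x \in A -> r x \in S.
Proof.
by have [_ _ _ tup _] := st; rewrite mem_seg => /andP[tx _]; apply: tup; apply: ltnW.
Qed.

Let r_fixS x : x \in S -> r x = x.
Proof. by have [RE _ _ _ _] := st; apply: (fix_up r_idem RE). Qed.

Lemma upper_levels : [/\ tower (Y1 :: Y2 :: s3), lev S 0 = Y1, lev S 1 = Y2,
  lev S 2 != set0 & type_mn (lev S 0 :|: lev S 1) 2 2].
Proof.
have [_ tow cY1 _ _] := st; have [s30 _] := upper_height.
have [_ tow2 _] := (tower_cat _ _).1 tow.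
have [nY1 lt1 tow3] := tow2; have [nY2 lt2 tow4] := tow3.
have [hY1 lY1] := section2_lev nY1 cY1; have [hY2 lY2] := section2_lev nY2 cY2.
have TL1 k := @tower_lev _ _ Y1 (Y2 :: s3) k tow2.
have TL2 k := @tower_lev _ _ Y2 s3 k tow3.
have l0 : lev S 0 = Y1 by rewrite /S TL1 leq0n.
have l1 : lev S 1 = Y2 by rewrite /S TL1 hY1 /= TL2.
split=> //.
  rewrite /S TL1 hY1 /= TL2 hY2 /=.
  by have [_] := tower_lev0 tow4 s30; rewrite -card_gt0 => /ltnW.
rewrite l0 l1; have := @type_mn_sum _ _ Y1 Y2; rewrite cY1 cY2; apply.
- by rewrite -lY1; apply: lev_anti.
- by rewrite -lY2; apply: lev_anti.
- by move=> x y xY yY; apply: lt1 => //; rewrite usum_cons inE yY.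
Qed.

Lemma upper_retraction : exists s : subposet A -> subposet A, retraction s /\
  let S' := s @: [set: subposet A] in
  [/\ tower_nice S', type_mn (lev S' 0 :|: lev S' 1) 2 2,
      s @: lev [set: subposet A] 1 :&: lev S' 0 = set0 & 2 <= height S'].
Proof.
have [RE tow1 cY1 tup1 Yup1] := st; have [s30 th] := upper_height.
have tA : t.+1 <= h by lia.
have [[f [e iA fK Kf]] _ _] := interval_subposet tA (leqnn h).
have [tow l0 l1 l2 ty] := upper_levels.
have rA (y : subposet A) : r (val y) \in S by apply: r_S; apply: valP.
exists (fun y => f (r (val y))); split.
  split=> [y|y z yz]; first by rewrite fK ?r_idem // S_up.
  by rewrite e ?S_up // r_mono.
have SE : [set f (r (val y)) | y in [set: subposet A]] = f @: S.
  apply/setP => y; apply/imsetP/imsetP => -[x xA ->]; first by exists (r (val x)).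
  by exists (f x); rewrite ?inE // fK ?r_fixS // S_up.
have eS : emb f S by apply: emb_sub e; apply/subsetP => x; apply: S_up.
rewrite /= SE; split.
- by apply: tower_nice_emb => //; apply/tower_niceP; exists (Y1 :: Y2 :: s3).
- rewrite !lev_emb // -imsetU; apply: type_mn_emb => //.
  by apply: emb_sub eS; rewrite subUset !lev_sub.
- rewrite lev_emb // l0; apply/setP => y; rewrite in_setI in_set0.
  apply/negP => /andP[/imsetP[x' xl ->] /imsetP[z zY E]].
  have ht : 1 <= h - t.+1 by lia.
  move: xl E; rewrite -iA (lev_emb _ e) (word_seg_lev Wd tA (leqnn h) ht) addn1.
  rewrite (wst_lev W) => /imsetP[x]; rewrite inE in_setT /= => /eqP xt -> E.
  have xA : x \in A by rewrite mem_seg (lv_le W) andbT xt.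
  have rx : r x \in usum (Y2 :: s3).
    (* Level 1 of the upper part is level [t.+2] of P, which [Y_above] sends strictly above [Y1]. *)
    by apply: (Y_above W r_idem r_mono RE tow1 cY1 tup1 Yup1); rewrite xt.
  have zS : z \in S by rewrite /S usum_cons inE zY.
  rewrite fK // in E; have rz := emb_inj eS (r_S xA) zS E.
  by have [_ lt1 _] := tow; have := lt1 _ _ zY rx; rewrite rz ltxx.
- by rewrite height_emb //; apply: lev_le_height.
Qed.

End UpperPart.
End Intervals.

Lemma stack_of_retract (d : Order.disp_t) (P : finPOrderType d) (r : P -> P) :
  in_N2 [set: P] -> retraction r -> tower_nice (r @: [set: P]) ->
  (exists l, type_mn (lev (r @: [set: P]) l :|: lev (r @: [set: P]) l.+1) 3 2) ->
  exists (dU dV dW : Order.disp_t) (U : finPOrderType dU)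
           (V : finPOrderType dV) (W : finPOrderType dW),
      stack3 P U V W /\
      [/\ crown6 [set: U] \/ in_N2 [set: U],
          [/\ in_N2Seg [set: V], section3 [set: V], 2 <= height [set: V],
              ~~ odd (height [set: V]) &
              stack3C (seg [set: V] 1 (height [set: V]))] &
          [/\ in_N2 [set: W], 3 <= height [set: W] &
              exists s : W -> W, retraction s /\
                let S := s @: [set: W] in
                [/\ tower_nice S, type_mn (lev S 0 :|: lev S 1) 2 2,
                    s @: lev [set: W] 1 :&: lev S 0 = set0 &
                    2 <= height S]]].
Proof.
move=> /N2_word[w [Wd h1 w0 wh]] [r_idem r_mono] /tower_niceP[s [s0 RE tow]] [l].
move/type_mn_lev=> /(_ isT isT); rewrite RE => -[e3 e2].
have [s1 [s2 [B [Y [sE sB cY]]]]] := tower32_split tow e3 e2.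
rewrite {}sE in RE tow.
have [c [lv [co W]]] := Wd; move: (height _) W Wd h1 wh => h W Wd h1 wh.
have h0 : 0 < h := ltnW h1.
have [m [mh wm mB up]] := above_section3 W r_idem r_mono RE tow sB.
(* The top crown of [B] fills levels [m] and [m.+1], so the map is controlled from [m.+2] on; [Y]
   dominates all of level [m.+1] and is therefore higher than [m.+2]. *)
have S0 : step_at lv r (s1 ++ [:: B]) Y s2 m.+2.
  split=> //; rewrite -?catA // => y yY.
  have [_ [_ lt _] _] := (tower_cat _ _).1 tow.
  have lty z : lv z = m.+1 -> (z < y)%O.
    by move=> /mB zB; apply: lt => //; rewrite usum_cons inE yY.
  have m1h : m.+1 < h.
    rewrite ltn_neqAle mh andbT; apply/negP => /eqP mh'.
    have [z zh zy] : exists2 z, lv z = m.+1 & (y <= z)%O.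
      have := lv_le W y; rewrite -mh' leq_eqVlt => /orP[/eqP yh|yh].
        by exists y.
      have [z zh /ltW] := up_at W yh mh; by exists z.
    by have := lt_geF (lty z zh); rewrite zy.
  exact: (strictly_all_below W m1h lty).
have [s1' [Y1 [Y2 [s3 [t [S1 cY2 [tm oddt] wt wt1]]]]]] :=
  climb W wh h0 r_idem r_mono S0.
have [s30 th] := upper_height W wh r_idem r_mono S1 cY2 wt1.
have ret := upper_retraction W wh r_idem r_mono S1 cY2 wt1.
have m1t : m.+1 <= t.+1 by apply: ltnW; apply: ltnW.
have th1 : t.+1 <= h by apply: ltnW; apply: ltnW; apply: ltnW.
(* The cuts are the top level of [B] and the level of [Y1], that is [m.+1] and [t.+1]. *)
have [_ WU iU] := interval_subposet W (leq0n m.+1) mh.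
have [_ WV iV] := interval_subposet W m1t th1.
have [_ WW iW] := interval_subposet W th1 (leqnn h).
exists d, d, d, (subposet (seg [set: P] 0 m.+1)),
  (subposet (seg [set: P] m.+1 t.+1)), (subposet (seg [set: P] t.+1 h)).
rewrite /stack3 (word_height Wd) (word_height WU) (word_height WV) (word_height WW).
rewrite subn0 !subnKC //; split=> //; split.
- have [m0|m0] := posnP m; last by right; apply: (interval_N2 W).
  by left; have [cU [lvU [coU WU']]] := WU; apply: (wst_crown6 WU'); rewrite // m0.
- have oddV : ~~ odd (t.+1 - m.+1).
    by have -> : t.+1 - m.+1 = (t - m.+2).+2; [move: tm; clear; lia | rewrite /= negbK].
  have wV i : m.+1 < i < t.+1 -> w i = false by rewrite ltnS; apply: wt.
  rewrite -(word_height WV); have [V1 V2 V3 V4] := interval_V W (tm : m.+2 < t.+1) th1 oddV wV.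
  by split=> //; apply: (interval_N2Seg W) => //; apply: ltnW (ltnW th).
- split=> //; last by move: th; clear; lia.
  by apply: (interval_N2 W) => //; apply: ltnW.
Qed.

(** * From a stack to a retract *)

Section Glueing.
Context {d : Order.disp_t} {P : finPOrderType d}.
Variables (h : nat) (w : nat -> bool).
Variables (c : nat -> 'I_3 -> P) (lv : P -> nat) (co : P -> 'I_3).
Hypothesis W : word_structure [set: P] h w c lv co.

(** A retraction of the levels from [k] upwards. Although [r] is total, its values below level [k]
    are left open, so they can be chosen when a lower level is added. *)
Record retract_above k (r : P -> P) (s : seq {set P}) : Prop := RetractAbove {
  ra_tower : tower s;
  ra_head : #|head set0 s| = 2;
  ra_up : {in usum s, forall x, k <= lv x};
  ra_in : forall x, k <= lv x -> r x \in usum s;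
  ra_fix : {in usum s, forall x, r x = x};
  ra_mono : forall x y, k <= lv x -> (x <= y)%O -> (r x <= r y)%O }.

(* The image avoids level [k], hence lies above every element of level [k.-1]. *)
Definition pushable k : Prop := exists r s,
  retract_above k r s /\ {in usum s, forall x, k < lv x}.

Lemma lv_mono x y : (x <= y)%O -> lv x <= lv y.
Proof. by rewrite le_eqVlt => /orP[/eqP ->//|/(lt_lv W)/ltnW]. Qed.

Lemma nice_antichain2 (a b : P) : a != b -> ~~ (a < b)%O -> ~~ (b < a)%O ->
  nice_section [set a; b].
Proof.
move=> ab nab nba; split; first by left; exists a, b.
by move=> x y; rewrite !inE => /orP[] /eqP -> /orP[] /eqP ->;
   rewrite ?ltxx ?(negPf nab) ?(negPf nba).
Qed.

(** Both levels of the 3C are sent to level [k.+1] by a map of colours with two values. Comparable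
    elements of a 3C have equal colours, so this is monotone. The old image avoids level [k.+2],
    hence lies above the two new elements. *)
Lemma pushable_step k : k < h -> w k = false -> pushable k.+2 -> pushable k.
Proof.
move=> kh wk [r [s [[tow hd up img fx mono] up']]].
pose p i : 'I_3 := if i == colour1 then colour1 else ord0.
pose a := c k.+1 ord0; pose b := c k.+1 colour1.
have lvc i : lv (c k.+1 i) = k.+1 by rewrite (c_lv W).
have abN : a != b by rewrite (wst_c_eq W) // I3_eq andbF.
have nlt i j : ~~ (c k.+1 i < c k.+1 j)%O.
  by apply/negP => /(lt_lv W); rewrite !lvc ltnn.
have pY i : c k.+1 (p i) \in [set a; b].
  by rewrite /p; case: ifP; rewrite !inE eqxx ?orbT.
have Yx x : x \in [set a; b] -> lv x = k.+1 /\ x = c k.+1 (p (co x)).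
  rewrite !inE => /orP[] /eqP ->; rewrite lvc (c_co W) //; split=> //.
    by rewrite /p I3_eq.
  by rewrite /p eqxx.
have lt : setlt [set a; b] (usum s).
  move=> x y /Yx[lx _] ys; apply: (lv_lt W); rewrite lx; exact: up'.
pose r' x := if lv x <= k.+1 then c k.+1 (p (co x)) else r x.
exists r', ([set a; b] :: s); split; last first.
  move=> x; rewrite usum_cons inE => /orP[/Yx[-> _]//|/up]; exact: ltnW.
split.
- by split=> //; apply: (nice_antichain2 abN (nlt _ _) (nlt _ _)).
- by rewrite /= cards2 abN.
- move=> x; rewrite usum_cons inE => /orP[/Yx[-> _]//|/up] kx.
  by apply: ltnW; apply: ltnW.
- move=> x kx; rewrite /r' usum_cons inE; case: leqP => [_|/img ->].
    by rewrite pY.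
  by rewrite orbT.
- move=> x; rewrite usum_cons inE /r' => /orP[/Yx[-> <-]|xs].
    by rewrite leqnn.
  by rewrite leqNgt (up x xs) fx.
- move=> x y kx xy; rewrite /r'; have lxy := lv_mono xy.
  case: leqP => xk; case: leqP => yk.
  + suff -> : co x = co y by [].
    move: xy; rewrite le_eqVlt => /orP[/eqP -> //|xy].
    have lt1 := lt_lv W xy; have lxk : lv x = k by lia.
    move: xy; rewrite (lt_succ W) lxk ?wk; last by lia.
    by move/eqP.
  + by apply/ltW/lt => //; apply: img.
  + lia.
  + exact: mono.
Qed.

Lemma pushable_down k n : k + n.*2 <= h ->
  (forall i, k <= i < k + n.*2 -> w i = false) -> pushable (k + n.*2) -> pushable k.
Proof.
elim: n => [|n IH]; first by rewrite addn0.
rewrite doubleS !addnS => nh wF pu; apply: IH; first lia.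
  by move=> i ik; apply: wF; lia.
by apply: pushable_step pu; [lia|apply: wF; lia].
Qed.

(** An element of level [k] follows its unique neighbour on level [k.+1] if that one goes into the
    head [Y]. Otherwise the neighbour goes above [Y] and any fixed element of [Y] will do. Elements
    of level [k.+2] or higher are all mapped above [Y], so monotonicity towards them is
    automatic. *)
Lemma pushable_base k r s : retract_above k.+1 r s -> w k = false -> k < h ->
  (forall x, lv x = k.+2 -> r x \notin head set0 s) -> pushable k.
Proof.
case: s => [|Y s] [tow /= hd up img fx mono] wk kh nY.
  by rewrite cards0 in hd.
have [nsY lt tows] := tow.
(* Higher elements dominate some element of level [k.+2], whose image is already above [Y]. *)
have Y0 x : lv x >= k.+2 -> r x \in usum s.
  rewrite leq_eqVlt => /orP[/eqP kx|kx].
    have := img x; rewrite -kx usum_cons inE leqnSn => /(_ isT) /orP[|//].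
    by rewrite (negPf (nY x _)).
  have [z zk zx] := down_at W kx.
  have rz : r z \in usum s.
    have := img z; rewrite zk usum_cons inE leqnSn => /(_ isT) /orP[|//].
    by rewrite (negPf (nY z _)).
  have := img x (ltnW (ltnW kx)); rewrite usum_cons inE => /orP[rY|//].
  have := lt_geF (lt _ _ rY rz); rewrite mono // ?zk //; exact: ltW.
have /card_gt0P[a aY] : 0 < #|Y| by rewrite hd.
pose r' x := if lv x <= k then
  (let y := r (c k.+1 (co x)) in if y \in Y then y else a) else r x.
have r'Y x : lv x <= k -> r' x \in Y by move=> xk; rewrite /r' xk /=; case: ifP.
exists r', (Y :: s); split; last by move=> x /up.
split=> //.
- by move=> x /up /ltnW.
- move=> x kx; case: (leqP (lv x) k) => xk.
    by rewrite usum_cons inE r'Y.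
  by rewrite /r' leqNgt xk; apply: img.
- by move=> x xs; rewrite /r' leqNgt up //= fx.
- move=> x y kx xy; have lxy := lv_mono xy.
  case: (leqP (lv x) k) => xk; last first.
    have xk' : (lv x <= k) = false by lia.
    have yk' : (lv y <= k) = false by lia.
    by rewrite /r' xk' yk'; apply: mono.
  move: xy; rewrite le_eqVlt => /orP[/eqP -> //|xy].
  have lt1 := lt_lv W xy; have lxk : lv x = k by lia.
  have yk : (lv y <= k) = false by lia.
  have [y2|y2] := leqP k.+2 (lv y).
    by apply/ltW/lt; rewrite ?r'Y // /r' yk Y0.
  have ly : lv y = k.+1 by lia.
  have cxy : co x = co y by move: xy; rewrite (lt_succ W) lxk ?wk ?ly // => /eqP.
  rewrite /r' xk yk /= cxy -ly (cK W); case: ifP => rY //.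
  apply/ltW/lt => //; have := img y; rewrite ly usum_cons inE rY leqnn; exact.
Qed.

End Glueing.

Lemma retract_of_stack (d : Order.disp_t) (P : finPOrderType d)
   (dU dV dW : Order.disp_t) (U : finPOrderType dU)
           (V : finPOrderType dV) (W : finPOrderType dW) :
  in_N2 [set: P] -> stack3 P U V W ->
      crown6 [set: U] \/ in_N2 [set: U] ->
      2 <= height [set: V] -> ~~ odd (height [set: V]) ->
      stack3C (seg [set: V] 1 (height [set: V])) ->
      (exists s : W -> W, retraction s /\
                let S := s @: [set: W] in
                [/\ tower_nice S, type_mn (lev S 0 :|: lev S 1) 2 2,
                    s @: lev [set: W] 1 :&: lev S 0 = set0 &
                    2 <= height S]) ->
  exists r : P -> P, retraction r /\
      let R := r @: [set: P] in
      tower_nice R /\ exists l : nat, type_mn (lev R l :|: lev R l.+1) 3 2.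
Proof.
move=> /N2_word[w [Wd h1 w0 wh]] [hE iU iV iW] hU hV2 oddV st3 [s [[s_idem s_mono]]].
move=> [/tower_niceP[q [q0 SE tow]] ty disj _].
have [c [lv [co Wp]]] := Wd.
move: (height [set: P]) hE Wp Wd h1 wh => h hE Wp Wd h1 wh.
set u := height [set: U] in hE iU iV iW; set v := height [set: V] in hE iV iW hV2 oddV st3.
set t := u + v in hE iV iW; set n := height [set: W] in hE iW.
rewrite -hE in iW.
have uh : u <= h by rewrite hE -addnA leq_addr.
have th : t <= h by rewrite hE leq_addr.
have ut : u <= t by rewrite leq_addr.
have isoword k l d' (Q : finPOrderType d') : k <= l -> l <= h ->
    poset_iso (seg [set: P] k l) [set: Q] ->
    word [set: Q] (l - k) (fun i => w (k + i)).
  move=> kl lh [f [_ fA e]]; rewrite -fA.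
  by apply: word_emb e _; apply: word_interval Wd _ _.
have WU := isoword _ _ _ _ (leq0n u) uh iU.
have WV := isoword _ _ _ _ ut th iV.
have [u0 wu] : 0 < u /\ w u.-1.
  have [wU [WU' u0 wU1]] : exists wU, [/\ word [set: U] u wU, 0 < u & wU u.-1].
    case: hU => [/crown6_word WU'|/N2_word[wU [WU' u1 _ wU1]]].
      by exists (fun=> true); rewrite /u (word_height WU').
    by exists wU; split=> //; apply: ltnW.
  split=> //; have [_ /(_ u.-1)] := word_uniq WU' WU.
  (* The letters of U agree with those of P, so the last letter below the cut is a crown. *)
  by rewrite prednK // leqnn => /(_ isT) => <-.
have wF i : 0 < i < v -> w (u + i) = false.
  have v0 : 0 < v by apply: ltnW.
  have WV' : word [set: V] v (fun i => w (u + i)).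
    by have := WV; rewrite /t addKn.
  exact: (word_stack3C WV' v0).1.
have [f [_ fA ef]] := iW; set A := seg [set: P] t h in fA ef.
have [g [eg gA fK]] := emb_inverse (c 0 ord0) ef; rewrite fA in eg gA.
have gf y : f (g y) = y.
  have /imsetP[x xA ->] : y \in f @: A by rewrite fA inE.
  by rewrite fK.
have memA x : (x \in A) = (t <= lv x) by rewrite (mem_seg Wp) (lv_le Wp) andbT.
have gAy y : g y \in A by rewrite -gA imset_f.
pose r x := g (s (f x)).
have ns_head : nice_section (head set0 q) /\ #|head set0 q| = 2.
  have [e1 _] := tower_lev0 tow q0.
  have [c2' _] := type_mn_lev (ltn0Sn 1) (ltn0Sn 1) ty; rewrite SE e1 in c2'.
  case: (q) q0 tow c2' => // Y q' _ [nY _ _] /= c2'; split=> //.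
  have [_ [[_ c3]|[_ _ -> //]]] := nice_section_lev nY.
  by rewrite c3 in c2'.
have levS0 : lev (usum q) 0 = head set0 q.
  have [-> _] := tower_lev0 tow q0.
  by have [nY cY] := ns_head; have [] := section2_lev nY cY.
pose q' := [seq g @: (B : {set W}) | B <- q].
have hd' : head set0 q' = g @: head set0 q.
  by rewrite /q'; case: (q) q0.
have uq' : usum q' = g @: usum q by rewrite /q' usum_emb.
have egq : emb g (usum q) by apply: emb_sub eg; apply: subsetT.
have fixS y : y \in usum q -> s y = y by rewrite -SE => /imsetP[z _ ->].
have ra : retract_above lv t r q'.
  split.
  - exact: tower_emb egq tow.
  - rewrite hd' card_in_imset; first by have [] := ns_head.
    by move=> x y _ _; apply: (emb_inj eg); rewrite inE.
  - by move=> x; rewrite uq' => /imsetP[y _ ->]; rewrite -memA.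
  - by move=> x _; rewrite uq' /r imset_f // -SE imset_f.
  - by move=> x; rewrite uq' /r => /imsetP[y yq ->]; rewrite gf fixS.
  - move=> x y tx xy; have ty' := leq_trans tx (lv_mono Wp xy).
    by rewrite /r eg ?inE // s_mono // ef ?memA.
have wt i : u < i < t -> w i = false.
  move=> /andP[ui it]; rewrite -(subnKC (ltnW ui)); apply: wF.
  by rewrite subn_gt0 ui ltn_subLR ?(ltnW ui).
have v0 : 0 < v by apply: ltnW.
(* The last 3C of V ends at W(0), the level [t]. The disjointness hypothesis on W(1) is what the
   extension by level [t.-1] requires. *)
have base : pushable lv t.-1.
  have tS : t.-1.+1 = t by rewrite prednK // /t addn_gt0 u0.
  rewrite -tS in ra; apply: (pushable_base Wp ra); try by rewrite ?tS.
    by apply: wt; rewrite /t; lia.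
  move=> x; rewrite tS => xt.
  rewrite hd' -levS0 /r; apply/negP => /imsetP[y yl].
  move=> /(emb_inj eg (in_setT _) (in_setT _)) E.
  have : s (f x) \in s @: lev [set: W] 1 :&: lev (s @: [set: W]) 0.
    rewrite in_setI SE E yl andbT -E imset_f // -fA (lev_emb _ ef).
    have th1 : 1 <= h - t by have := lv_le Wp x; rewrite xt; lia.
    rewrite imset_f // (word_seg_lev Wd th (leqnn h) th1) addn1 (wst_lev Wp).
    by rewrite inE in_setT xt eqxx.
  by rewrite disj in_set0.
have [r1 [q1 [[tow1 hd1 up1 in1 fix1 mono1] up1']]] : pushable lv u.+1.
  (* As [v] is even, the levels from [u.+1] to [t.-2] group into pairs, each of them a 3C. *)
  have E : t.-1 = u.+1 + (v./2.-1).*2.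
    by have := odd_double_half v; rewrite (negPf oddV) /t; lia.
  apply: (pushable_down Wp (n := v./2.-1)); rewrite -?E //.
    by apply: leq_trans th; apply: leq_pred.
  by move=> i /andP[ui it]; apply: wt; lia.
pose B := seg [set: P] 0 u.
have memB x : (x \in B) = (lv x <= u) by rewrite (mem_seg Wp) leq0n.
(* The image above avoids level [u.+1], so it is at least two levels above [B], whatever the letter
   [w u] is. *)
have ltB : setlt B (usum q1).
  by move=> x y; rewrite memB => xu /up1' uy; apply: (lv_lt Wp); lia.
have nsB : nice_section B.
  have [cB [lvB [coB WB]]] := word_interval Wd (leq0n u) uh.
  split; first by right; apply: (wst_section3 WB); rewrite subn0.
  by apply: (wst_nice WB); rewrite ?subn0.
have hB : height B = u by rewrite (word_height (word_interval Wd (leq0n u) uh)) subn0.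
pose R x := if lv x <= u then x else r1 x.
have RE : R @: [set: P] = usum (B :: q1).
  apply/setP => y; rewrite usum_cons in_setU memB; apply/imsetP/orP.
    move=> [x _ ->]; rewrite /R; have [xu|xu] := leqP (lv x) u; first by left.
    by right; apply: in1.
  case=> yu; exists y; rewrite // /R ?yu //.
  by rewrite leqNgt up1 //= fix1.
have towR : tower (B :: q1) by [].
exists R; split.
  split=> [x|x y xy]; rewrite /R.
    have [xu|xu] := leqP (lv x) u; first by rewrite xu.
    have xq := in1 x xu.
    by rewrite leqNgt up1 //= fix1.
  have lxy := lv_mono Wp xy.
  have [xu|xu] := leqP (lv x) u; have [yu|yu] := leqP (lv y) u => //; last exact: mono1.
    by apply/ltW/ltB; rewrite ?memB // in1.
  by lia.
rewrite /= RE; split; first by apply/tower_niceP; exists (B :: q1).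
exists u; have TL k := @tower_lev _ _ B q1 k towR.
have q10 : q1 != [::] by apply: contra_eqN hd1 => /eqP ->; rewrite cards0.
have [nsY tow1'] : nice_section (head set0 q1) /\ True.
  by case: (q1) q10 tow1 => // Y q2 _ [].
rewrite !TL hB leqnn ltnn subnn; have [-> _] := tower_lev0 tow1 q10.
have [_ ->] := section2_lev nsY hd1.
have cB : #|lev B u| = 3.
  have [_ [[_ c3]|[h0 _ _ _]]] := nice_section_lev nsB; first by rewrite c3 ?hB.
  by rewrite hB in h0; rewrite h0 in u0.
have := @type_mn_sum _ _ (lev B u) (head set0 q1); rewrite cB hd1; apply.
- exact: lev_anti.
- have [_ <-] := section2_lev nsY hd1; exact: lev_anti.
- move=> x y /(subsetP (lev_sub _ _)) xB yq; apply: ltB => //.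
  by apply/mem_usum; exists (head set0 q1) => //; case: (q1) q10 => // Y q2 _; rewrite mem_head.
Qed.

Theorem theorem5p4 (d : Order.disp_t) (P : finPOrderType d) :
  in_N2 [set: P] ->
  ((exists r : P -> P, retraction r /\
      let R := r @: [set: P] in
      tower_nice R /\ exists l : nat, type_mn (lev R l :|: lev R l.+1) 3 2)
   <->
   (exists (dU dV dW : Order.disp_t) (U : finPOrderType dU)
           (V : finPOrderType dV) (W : finPOrderType dW),
      stack3 P U V W /\
      [/\ crown6 [set: U] \/ in_N2 [set: U],
          [/\ in_N2Seg [set: V], section3 [set: V], 2 <= height [set: V],
              ~~ odd (height [set: V]) &
              stack3C (seg [set: V] 1 (height [set: V]))] &
          [/\ in_N2 [set: W], 3 <= height [set: W] &
              exists s : W -> W, retraction s /\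
                let S := s @: [set: W] in
                [/\ tower_nice S, type_mn (lev S 0 :|: lev S 1) 2 2,
                    s @: lev [set: W] 1 :&: lev S 0 = set0 &
                    2 <= height S]]])).
Proof.
move=> N2P; split.
  move=> [r [rr [tow l32]]].
  exact: (@stack_of_retract d P r N2P rr tow l32).
move=> [dU [dV [dW [U [V [W [st [hU [_ _ hV ev s3] [_ _ hW]]]]]]]]].
exact: (@retract_of_stack d P dU dV dW U V W N2P st hU hV ev s3 hW).
Qed.
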